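(* Let $A\in\mathbb{R}^{n\times n}$ be neutrally stable, let $C\in\mathbb{R}^{m\times n}$ be such that $(C,A)$ is detectable, and let $L\in\mathbb{R}^{n\times m}$ be constructed from $(C,A)$ according to the algorithm given in the context. Then for every $p$ and every connected interconnection $\Gamma=[\gamma_{ij}]\in\mathbb{R}^{p\times p}$, the solutions $x_i(\cdot)$, $i=1,\ldots,p$, of the systems $$\dot{x}_i=Ax_i+u_i,\quad y_i=Cx_i,\quad z_i=\sum_{j\neq i}\gamma_{ij}(y_j-y_i),\quad u_i=Lz_i,\qquad x_i\in\mathbb{R}^n,$$ synchronize to $$\bar{x}(t):=(r^{T}\otimes e^{At})\begin{bmatrix}x_1(0)\\ \vdots\\ x_p(0)\end{bmatrix},$$ where $r\in\mathbb{R}^p$ is such that $r^T\Gamma=0$ and $r^T\mathbf{1}=1$.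
   Context: $\mathbf{1}\in\mathbb{R}^p$ is the vector with all entries equal to one; $\otimes$ is the Kronecker product. Neutrally stable: $A$ has no eigenvalue with positive real part, and every Jordan block corresponding to an eigenvalue on the imaginary axis has size one. Detectable: for every $x\in\mathbb{R}^n$, $Ce^{At}x=0$ for all $t\geq0$ implies $\lim_{t\to\infty}e^{At}x=0$. $\Gamma=[\gamma_{ij}]\in\mathbb{R}^{p\times p}$ is an interconnection if $\gamma_{ij}\geq 0$ for $i\neq j$ and $\gamma_{ii}=-\sum_{j\neq i}\gamma_{ij}$. Its graph is the directed graph with nodes $n_1,\ldots,n_p$ in which $(n_i,n_j)$ is an edge iff $\gamma_{ij}>0$. $\Gamma$ is connected if this graph has a node to which there exists a (directed) path from every other node. For connected $\Gamma$, the vector $r$ with $r^T\Gamma=0$ and $r^T\mathbf{1}=1$ exists and is unique. Maps $\xi_i:\mathbb{R}_{\geq 0}\to\mathbb{R}^n$, $i=1,\ldots,p$, synchronize to $\bar\xi:\mathbb{R}_{\geq0}\to\mathbb{R}^n$ if $|\xi_i(t)-\bar\xi(t)|\to0$ as $t\to\infty$ for all $i$. Algorithm (input: neutrally stable $A\in\mathbb{R}^{n\times n}$ and $C\in\mathbb{R}^{m\times n}$; output: $L\in\mathbb{R}^{n\times m}$). Let $n_1\leq n$ be the number of eigenvalues of $A$ (counted with multiplicity) on the imaginary axis, and $n_2:=n-n_1$. If $n_1=0$, let $L:=0$. Otherwise: Step 1: choose $U\in\mathbb{R}^{n\times n_1}$ and $W\in\mathbb{R}^{n\times n_2}$ with $$[U\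 W]^{-1}A[U\ W]=\begin{bmatrix}F&0\\0&G\end{bmatrix},$$ where all the eigenvalues of $F\in\mathbb{R}^{n_1\times n_1}$ have zero real parts. Step 2: let $P:=\lim_{t\to\infty}t^{-1}\int_0^t e^{F^T\tau}e^{F\tau}\,d\tau\in\mathbb{R}^{n_1\times n_1}$ (this limit exists and is symmetric positive definite). Step 3: let $L:=UP^{-1}(CU)^T$. *)

(* Defs.v *)
From HB Require Import structures.
From mathcomp Require Import all_boot all_order all_algebra.
From mathcomp Require Import complex mxtens.
From mathcomp Require Import all_classical all_reals all_analysis.

Set Implicit Arguments.
Unset Strict Implicit.
Unset Printing Implicit Defensive.

Import Order.TTheory GRing.Theory Num.Theory.
Import numFieldNormedType.Exports.

Local Open Scope classical_set_scope.
Local Open Scope ring_scope.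

(* The library norm on matrices is the sup norm; this is the Euclidean one. *)
Definition enorm (R : realType) (n : nat) (v : 'cV[R]_n) : R :=
  Num.sqrt (\sum_k v k 0 ^+ 2).

Definition expm (R : realType) (n : nat) (M : 'M[R]_n) : 'M[R]_n :=
  limn (series (fun k => (k`!%:R)^-1 *: M ^+ k)).

Definition complexify (R : realType) (m n : nat) (M : 'M[R]_(m, n)) :
    'M[R[i]]_(m, n) :=
  map_mx (real_complex R) M.

(* Complex eigenvalues, repeated according to algebraic multiplicity. *)
Definition eigenvalues (R : realType) (n : nat) (A : 'M[R]_n) : seq R[i] :=
  sval (closed_field_poly_normal (char_poly (complexify A))).

Definition imag_dim (R : realType) (n : nat) (A : 'M[R]_n) : nat :=
  count (fun z : R[i] => complex.Re z == 0) (eigenvalues A).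

(* S and T may have formally different dimensions n and k: being two-sided
   inverses forces n = k. This avoids casts when k is a sum of block sizes. *)
Definition mutual_inverse (K : fieldType) (n k : nat)
    (S : 'M[K]_(n, k)) (T : 'M[K]_(k, n)) : Prop :=
  S *m T = 1%:M /\ T *m S = 1%:M.

Definition jordan_block (K : fieldType) (k : nat) (lam : K) : 'M[K]_k :=
  \matrix_(i, j) ((i == j)%:R * lam + (i.+1 == j :> nat)%:R).

Definition jordan_form (K : fieldType) (n : nat) (A : 'M[K]_n)
    (N : nat) (size : 'I_N -> nat) (lam : 'I_N -> K) : Prop :=
  (forall b, (0 < size b)%N) /\
  exists (S : 'M[K]_(n, \sum_b size b)) (T : 'M[K]_(\sum_b size b, n)),
    mutual_inverse S T /\
    T *m A *m S = \mxdiag_b jordan_block (size b) (lam b).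

(* The Jordan form exists over R[i] and is unique up to the order of blocks,
   so quantifying existentially over it is just a way of naming it. *)
Definition neutrally_stable (R : realType) (n : nat) (A : 'M[R]_n) : Prop :=
  (forall z : R[i], eigenvalue (complexify A) z -> complex.Re z <= 0) /\
  exists (N : nat) (size : 'I_N -> nat) (lam : 'I_N -> R[i]),
    jordan_form (complexify A) size lam /\
    forall b, complex.Re (lam b) = 0 -> size b = 1%N.

Definition detectable (R : realType) (n m : nat)
    (C : 'M[R]_(m, n)) (A : 'M[R]_n) : Prop :=
  forall x : 'cV[R]_n,
    (forall t : R, 0 <= t -> C *m expm (t *: A) *m x = 0) ->
    expm (t *: A) *m x @[t --> +oo] --> (0 : 'cV[R]_n).

Definition interconnection (R : realType) (p : nat) (G : 'M[R]_p) : Prop :=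
  (forall i j, i != j -> 0 <= G i j) /\
  (forall i, G i i = - \sum_(j | j != i) G i j).

Definition edge (R : realType) (p : nat) (G : 'M[R]_p) : rel 'I_p :=
  [rel i j | 0 < G i j].

Definition connected_interconnection (R : realType) (p : nat)
    (G : 'M[R]_p) : Prop :=
  interconnection G /\ exists i, forall j, j != i -> connect (edge G) j i.

Definition synchronize (R : realType) (n p : nat)
    (xi : 'I_p -> R -> 'cV[R]_n) (xibar : R -> 'cV[R]_n) : Prop :=
  forall i, enorm (xi i t - xibar t) @[t --> +oo] --> (0 : R).

Definition gram_average (R : realType) (k : nat) (F : 'M[R]_k) (t : R) :
    'M[R]_k :=
  t^-1 *: \matrix_(i, j) \int[lebesgue_measure]_(tau in `[0, t])
            (expm (tau *: F^T) *m expm (tau *: F)) i j.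

(* The algorithm involves a choice of U and W, hence is a relation:
   L is a possible output on input (C, A). *)
Definition algorithm_output (R : realType) (n m : nat)
    (C : 'M[R]_(m, n)) (A : 'M[R]_n) (L : 'M[R]_(n, m)) : Prop :=
  let n1 := imag_dim A in
  let n2 := (n - n1)%N in
  if n1 == 0%N then L = 0 else
  exists (U : 'M[R]_(n, n1)) (W : 'M[R]_(n, n2)) (V : 'M[R]_(n1 + n2, n))
         (F : 'M[R]_n1) (G : 'M[R]_n2) (P : 'M[R]_n1),
    [/\ mutual_inverse (row_mx U W) V,
        V *m A *m row_mx U W = block_mx F 0 0 G,
        forall z : R[i], eigenvalue (complexify F) z -> complex.Re z = 0,
        gram_average F t @[t --> +oo] --> P &
        L = U *m invmx P *m (C *m U)^T].

(* x need only be meaningful on [0, +oo[: continuity there and the equations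
   on ]0, +oo[ amount to a solution with a one-sided derivative at 0. *)
Definition coupled_solution (R : realType) (n m p : nat)
    (A : 'M[R]_n) (C : 'M[R]_(m, n)) (L : 'M[R]_(n, m)) (G : 'M[R]_p)
    (x : 'I_p -> R -> 'cV[R]_n) : Prop :=
  let y := fun i t => C *m x i t in
  let z := fun i t => \sum_(j | j != i) G i j *: (y j t - y i t) in
  let u := fun i t => L *m z i t in
  forall i,
    {within `[0, +oo[, continuous (x i)} /\
    forall t : R, 0 < t -> is_derive t 1 (x i) (A *m x i t + u i t).

(* Row ordering matches that of tensmx. *)
Definition stack (R : realType) (n p : nat) (v : 'I_p -> 'cV[R]_n) :
    'cV[R]_(p * n) :=
  \col_k v (mxtens_unindex k).1 (mxtens_unindex k).2 0.

Definition consensus_trajectory (R : realType) (n p : nat) (A : 'M[R]_n)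
    (r : 'cV[R]_p) (x0 : 'I_p -> 'cV[R]_n) (t : R) : 'cV[R]_n :=
  castmx (mul1n n, erefl 1%N) (tensmx r^T (expm (t *: A)) *m stack x0).

(* Main.v *)
(* Write the network as [X' = A X + L C X Gamma^T], the columns of the [n x p]
   matrix [X] being the states. Since [Gamma^T r = 0], [X r] solves the
   uncoupled equation, so [X r = e^(At) X(0) r], and the disagreement
   [Y = X - X r 1^T] satisfies [Y r = 0] and
     [Y' = A Y + L C Y Gamma^T - Y r 1^T].
   It remains to see that this linear operator is Hurwitz. An eigenvector [Y]
   with [Y r != 0] makes its eigenvalue plus one an eigenvalue of [A].
   Otherwise, right multiplication by [Gamma^T] preserves the eigenspace, so
   [Y] may be taken with [Y Gamma^T = la Y]; connectedness excludes [la = 0],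
   Gershgorin gives [Re la < 0], and the eigenvalue is one of [A + la L C].
   On the stable block of [A] this is [G], which is Hurwitz; on the imaginary
   block it is [F + la P^-1 H^T H] with [H = C U], which the quadratic form [P]
   controls: [P F] is skew, so an eigenvalue with nonnegative real part forces
   [H v = 0], hence [F v = mu v], contradicting detectability. *)
Require Import Defs.
From mathcomp Require Import all_boot all_order all_algebra.
From mathcomp Require Import complex mxtens ring lra.
From mathcomp Require Import all_classical all_reals all_analysis.

Set Implicit Arguments.
Unset Strict Implicit.
Unset Printing Implicit Defensive.

Import Order.TTheory GRing.Theory Num.Theory.
Import numFieldNormedType.Exports.

Local Open Scope classical_set_scope.
Local Open Scope ring_scope.

(** * Real and imaginary parts *)

Section RealPairs.
Context {R : realType}.
Implicit Types (m n k : nat) (z : R[i]).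

(** Spectral data are complex, whereas [dot], derivatives and limits are real; complex identities
    are used through their real and imaginary parts. *)
Definition Re_mx m n (Z : 'M[R[i]]_(m, n)) : 'M[R]_(m, n) :=
  map_mx (@complex.Re R) Z.
Definition Im_mx m n (Z : 'M[R[i]]_(m, n)) : 'M[R]_(m, n) :=
  map_mx (@complex.Im R) Z.

Lemma Re_sum (I : finType) (P : pred I) (F : I -> R[i]) :
  complex.Re (\sum_(i | P i) F i) = \sum_(i | P i) complex.Re (F i).
Proof. by apply: (big_morph (@complex.Re R)) => // -[a b] [c d]. Qed.

Lemma Im_sum (I : finType) (P : pred I) (F : I -> R[i]) :
  complex.Im (\sum_(i | P i) F i) = \sum_(i | P i) complex.Im (F i).
Proof. by apply: (big_morph (@complex.Im R)) => // -[a b] [c d]. Qed.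

Lemma ReM z1 z2 : complex.Re (z1 * z2) =
  complex.Re z1 * complex.Re z2 - complex.Im z1 * complex.Im z2.
Proof. by case: z1 z2 => a b [c d]. Qed.

Lemma ImM z1 z2 : complex.Im (z1 * z2) =
  complex.Im z1 * complex.Re z2 + complex.Re z1 * complex.Im z2.
Proof. by case: z1 z2 => a b [c d] /=; rewrite addrC. Qed.

Lemma Re_mx_mul m n k (Y : 'M[R[i]]_(m, n)) (Z : 'M[R[i]]_(n, k)) :
  Re_mx (Y *m Z) = Re_mx Y *m Re_mx Z - Im_mx Y *m Im_mx Z.
Proof.
apply/matrixP => i j; rewrite !mxE Re_sum -sumrB.
by apply: eq_bigr => l _; rewrite !mxE ReM.
Qed.

Lemma Im_mx_mul m n k (Y : 'M[R[i]]_(m, n)) (Z : 'M[R[i]]_(n, k)) :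
  Im_mx (Y *m Z) = Im_mx Y *m Re_mx Z + Re_mx Y *m Im_mx Z.
Proof.
apply/matrixP => i j; rewrite !mxE Im_sum -big_split /=.
by apply: eq_bigr => l _; rewrite !mxE ImM.
Qed.

Lemma Re_complexify m n (A : 'M[R]_(m, n)) : Re_mx (complexify A) = A.
Proof. by apply/matrixP => i j; rewrite !mxE. Qed.

Lemma Im_complexify m n (A : 'M[R]_(m, n)) : Im_mx (complexify A) = 0.
Proof. by apply/matrixP => i j; rewrite !mxE. Qed.

Lemma Re_mxZ m n z (Z : 'M[R[i]]_(m, n)) :
  Re_mx (z *: Z) = complex.Re z *: Re_mx Z - complex.Im z *: Im_mx Z.
Proof. by apply/matrixP => i j; rewrite !mxE ReM. Qed.

Lemma Im_mxZ m n z (Z : 'M[R[i]]_(m, n)) :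
  Im_mx (z *: Z) = complex.Im z *: Re_mx Z + complex.Re z *: Im_mx Z.
Proof. by apply/matrixP => i j; rewrite !mxE ImM. Qed.

Lemma Re_mxD m n (Y Z : 'M[R[i]]_(m, n)) : Re_mx (Y + Z) = Re_mx Y + Re_mx Z.
Proof. by apply/matrixP => i j; rewrite !mxE; case: (Y i j) (Z i j) => ? ? []. Qed.

Lemma Im_mxD m n (Y Z : 'M[R[i]]_(m, n)) : Im_mx (Y + Z) = Im_mx Y + Im_mx Z.
Proof. by apply/matrixP => i j; rewrite !mxE; case: (Y i j) (Z i j) => ? ? []. Qed.

Lemma Re_mx0 m n : Re_mx (0 : 'M[R[i]]_(m, n)) = 0.
Proof. by apply/matrixP => i j; rewrite !mxE. Qed.

Lemma Im_mx0 m n : Im_mx (0 : 'M[R[i]]_(m, n)) = 0.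
Proof. by apply/matrixP => i j; rewrite !mxE. Qed.

Lemma Re_Im_mx_inj m n (Y Z : 'M[R[i]]_(m, n)) :
  Re_mx Y = Re_mx Z -> Im_mx Y = Im_mx Z -> Y = Z.
Proof.
move=> /matrixP rYZ /matrixP iYZ; apply/matrixP => i j.
move: (rYZ i j) (iYZ i j); rewrite !mxE.
by case: (Y i j) (Z i j) => ? ? [? ?] /= -> ->.
Qed.

Lemma Re_mul_real m n k (A : 'M[R]_(m, n)) (Z : 'M[R[i]]_(n, k)) :
  Re_mx (complexify A *m Z) = A *m Re_mx Z.
Proof. by rewrite Re_mx_mul Re_complexify Im_complexify mul0mx subr0. Qed.

Lemma Im_mul_real m n k (A : 'M[R]_(m, n)) (Z : 'M[R[i]]_(n, k)) :
  Im_mx (complexify A *m Z) = A *m Im_mx Z.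
Proof. by rewrite Im_mx_mul Re_complexify Im_complexify mul0mx add0r. Qed.

Lemma complexifyM m n k (A : 'M[R]_(m, n)) (B : 'M[R]_(n, k)) :
  complexify (A *m B) = complexify A *m complexify B.
Proof. exact: map_mxM. Qed.

Lemma complexifyD m n (A B : 'M[R]_(m, n)) :
  complexify (A + B) = complexify A + complexify B.
Proof. exact: map_mxD. Qed.

Lemma complexify1 n : complexify (1%:M : 'M[R]_n) = 1%:M.
Proof. exact: map_mx1. Qed.

Lemma complexify0 m n : complexify (0 : 'M[R]_(m, n)) = 0.
Proof. exact: map_mx0. Qed.

Lemma complexify_tr m n (A : 'M[R]_(m, n)) : complexify A^T = (complexify A)^T.
Proof. by apply/matrixP => i j; rewrite !mxE. Qed.

End RealPairs.

(** * Eigenvalues and characteristic polynomials *)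

Section Eigenvalues.

Lemma char_poly_tr (K : fieldType) n (M : 'M[K]_n) :
  char_poly M^T = char_poly M.
Proof.
rewrite /char_poly -det_tr; congr (\det _).
by apply/matrixP => i j; rewrite !mxE eq_sym.
Qed.

Lemma eigenvalue_tr (K : fieldType) n (M : 'M[K]_n) a :
  eigenvalue M^T a = eigenvalue M a.
Proof. by rewrite !eigenvalue_root_char char_poly_tr. Qed.

(** [eigenvalue] refers to row eigenvectors; a matrix and its transpose have the same characteristic
    polynomial, so columns serve as well. *)
Lemma eigenvalue_colP (K : fieldType) n (M : 'M[K]_n) a :
  reflect (exists2 w : 'cV[K]_n, M *m w = a *: w & w != 0) (eigenvalue M a).
Proof.
rewrite -eigenvalue_tr; apply: (iffP eigenvalueP) => [[v vM v0]|[w Mw w0]].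
  exists v^T; last by rewrite trmx_eq0.
  by apply: trmx_inj; rewrite trmx_mul trmxK vM linearZ /= trmxK.
exists w^T; last by rewrite trmx_eq0.
by rewrite -trmx_mul Mw linearZ.
Qed.

Lemma mem_eigenvalues (R : realType) n (A : 'M[R]_n) z :
  (z \in eigenvalues A) = eigenvalue (complexify A) z.
Proof.
rewrite eigenvalue_root_char /eigenvalues.
case: closed_field_poly_normal => s /= ->.
by rewrite (monicP (char_poly_monic _)) scale1r root_prod_XsubC.
Qed.

Lemma char_poly_eigenvalues (R : realType) n (A : 'M[R]_n) :
  char_poly (complexify A) = \prod_(z <- eigenvalues A) ('X - z%:P).
Proof.
rewrite /eigenvalues; case: closed_field_poly_normal => s /= {1}->.
by rewrite (monicP (char_poly_monic _)) scale1r.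
Qed.

(** Cayley-Hamilton with the characteristic polynomial split into linear factors. The [foldr] form
    lets inductions peel off one factor at a time from the left. *)
Lemma annihilating_product (K : closedFieldType) n (M : 'M[K]_n) :
  exists2 s : seq K, {in s, forall z, eigenvalue M z} &
    foldr (fun z B => (M - z%:M) *m B) 1%:M s = 0.
Proof.
case: n M => [|n] M.
  by exists [::] => //; apply/matrixP => -[].
have [s Es] := closed_field_poly_normal (char_poly M).
move: Es; rewrite (monicP (char_poly_monic _)) scale1r => Es.
exists s => [z zs|]; first by rewrite eigenvalue_root_char Es root_prod_XsubC.
suff: horner_mx M (\prod_(z <- s) ('X - z%:P)) = 0.
  move=> <-; elim: s {Es} => [|z s IH] /=.
    by rewrite big_nil [RHS]rmorph1.
  by rewrite big_cons rmorphM rmorphB /= horner_mx_X horner_mx_C IH.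
by rewrite -Es Cayley_Hamilton.
Qed.

Lemma char_poly_similar (K : fieldType) n k (A : 'M[K]_n) (B : 'M[K]_k)
    (S : 'M[K]_(n, k)) (T : 'M[K]_(k, n)) :
  mutual_inverse S T -> T *m A *m S = B -> char_poly A = char_poly B.
Proof.
move=> [ST TS] TAS.
(* Ranks force equal dimensions, after which the determinants of [S] and [T] make sense. *)
have kn : k = n.
  apply/eqP; rewrite eqn_leq; apply/andP; split.
    by rewrite -(mxrank1 K k) -TS (leq_trans (mxrankM_maxl _ _)) ?rank_leq_col.
  by rewrite -(mxrank1 K n) -ST (leq_trans (mxrankM_maxl _ _)) ?rank_leq_col.
subst k.
have TuK : \det T * \det S = 1 by rewrite -det_mulmx TS det1.
rewrite /char_poly -TAS.
have -> : char_poly_mx (T *m A *m S) =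
    map_mx polyC T *m char_poly_mx A *m map_mx polyC S.
  rewrite /char_poly_mx mulmxBr mulmxBl !map_mxM /=; congr (_ - _).
  by rewrite scalar_mxC -mulmxA -map_mxM TS map_mx1 mulmx1.
rewrite !det_mulmx mulrAC !det_map_mx -rmorphM TuK rmorph1.
by rewrite mul1r.
Qed.

End Eigenvalues.

(** * Eigenvalues of interconnections *)

Section Interconnection.
Context {R : realType} {p : nat} (Gamma : 'M[R]_p).
Hypothesis GammaC : connected_interconnection Gamma.

Lemma interconnection_mul (a : 'cV[R]_p) i :
  (Gamma *m a) i 0 = \sum_(j | j != i) Gamma i j * (a j 0 - a i 0).
Proof.
have [[_ dG] _] := GammaC.
rewrite mxE (bigD1 i) //= dG mulNr mulr_suml addrC -sumrB.
by apply: eq_bigr => j _; rewrite mulrBr.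
Qed.

Lemma interconnection_mul1 : Gamma *m (const_mx 1 : 'cV[R]_p) = 0.
Proof.
apply/colP => i; rewrite interconnection_mul big1 ?mxE // => j _.
by rewrite !mxE subrr mulr0.
Qed.

(** Maximum principle: at a node where [a] is maximal, [Gamma *m a] is a sum of nonpositive terms.
    Its vanishing makes every out-neighbour maximal too, and a path carries the maximum to the root
    [q]. *)
Lemma kernel_le_root (q : 'I_p) (a : 'cV[R]_p) :
  (forall j, j != q -> connect (edge Gamma) j q) ->
  Gamma *m a = 0 -> forall j, a j 0 <= a q 0.
Proof.
move=> qP Ga; have [[oG dG] _] := GammaC.
have [i _ iM] := @arg_maxP _ _ _ q predT (fun i => a i 0) isT.
have step j k : a j 0 = a i 0 -> edge Gamma j k -> a k 0 = a i 0.
  move=> aj jk; have [->//|kj] := eqVneq k j.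
  have /eqP := congr1 (fun M : 'cV[R]_p => M j 0) Ga.
  rewrite interconnection_mul mxE => /eqP S0.
  have : \sum_(l | l != j) Gamma j l * (a j 0 - a l 0) == 0.
    by rewrite -oppr_eq0 -sumrN -{2}S0; apply/eqP/eq_bigr => l _; ring.
  rewrite psumr_eq0 => [/allP/(_ k (mem_index_enum _))|l lj]; last first.
    by rewrite mulr_ge0 ?oG 1?eq_sym // subr_ge0 aj; exact: iM.
  rewrite kj /= mulf_eq0 (gt_eqF jk) /= subr_eq0 => /eqP <-.
  by [].
have reach s : forall j, a j 0 = a i 0 -> path (edge Gamma) j s ->
    a (last j s) 0 = a i 0.
  elim: s => [//|l s IH] j aj /= /andP[jl ls].
  by apply: IH => //; exact: step jl.
have aq : a q 0 = a i 0.
  have [->//|iq] := eqVneq i q.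
  by have /connectP[s es ->] := qP i iq; exact: reach.
by move=> j; rewrite aq; exact: iM.
Qed.

(** The maximum principle for [a] and for [- a] squeezes every entry to the one at the root. *)
Lemma interconnection_kernel (a : 'cV[R]_p) : Gamma *m a = 0 ->
  exists c, a = const_mx c.
Proof.
move=> Ga; have [_ [q qP]] := GammaC.
exists (a q 0); apply/colP => j; rewrite mxE; apply/le_anti.
rewrite (kernel_le_root qP Ga) /=.
have NGa : Gamma *m (- a) = 0 by rewrite mulmxN Ga oppr0.
by have := kernel_le_root qP NGa j; rewrite !mxE lerN2.
Qed.

(* Gershgorin: at a row [i] where [|w i|] is maximal, every term
   [Re (conj (w i) * (w j - w i))] is nonpositive. *)
Lemma interconnection_eigenvalue z : eigenvalue (complexify Gamma) z ->
  z = 0 \/ complex.Re z < 0.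
Proof.
move=> /eigenvalue_colP[w Gw w0].
have [[oG _] _] := GammaC.
pose a := Re_mx w; pose b := Im_mx w.
have Ga : Gamma *m a = complex.Re z *: a - complex.Im z *: b.
  by rewrite -Re_mul_real Gw Re_mxZ.
have Gb : Gamma *m b = complex.Im z *: a + complex.Re z *: b.
  by rewrite -Im_mul_real Gw Im_mxZ.
pose h i := a i 0 ^+ 2 + b i 0 ^+ 2.
have [i0 hi0] : exists i, 0 < h i.
  have [i wi] : exists i, w i 0 != 0.
    apply/existsP; rewrite -negb_forall; apply: contraNN w0 => /forallP w0.
    by apply/eqP/colP => i; rewrite mxE; apply/eqP/w0.
  exists i; rewrite lt_neqAle addr_ge0 ?sqr_ge0 // andbT eq_sym.
  rewrite paddr_eq0 ?sqr_ge0 // !sqrf_eq0 !mxE.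
  by move: wi; rewrite eq_complex.
move: @h hi0; clearbody a b => h hi0.
have [i _ iM] := @arg_maxP _ _ _ i0 predT h isT.
have hi : 0 < h i by exact: lt_le_trans hi0 (iM _ isT).
pose T j := Gamma i j * (a i 0 * (a j 0 - a i 0) + b i 0 * (b j 0 - b i 0)).
have ReS : complex.Re z * h i = \sum_(j | j != i) T j.
  transitivity (a i 0 * (Gamma *m a) i 0 + b i 0 * (Gamma *m b) i 0).
    by rewrite Ga Gb !mxE /h; ring.
  rewrite !interconnection_mul !mulr_sumr -big_split /=.
  by apply: eq_bigr => j _; rewrite /T; ring.
(* Twice the left side is [|w j|^2 - |w i|^2 - |w j - w i|^2], and [i] maximizes the modulus. *)
have Tle j : a i 0 * (a j 0 - a i 0) + b i 0 * (b j 0 - b i 0) <=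
    - ((a j 0 - a i 0) ^+ 2 + (b j 0 - b i 0) ^+ 2) / 2.
  have : h j <= h i by exact: iM.
  by rewrite /h !expr2; lra.
have T0 j : j != i -> T j <= 0.
  move=> ji; rewrite /T mulr_ge0_le0 ?oG 1?eq_sym //.
  apply: le_trans (Tle j) _.
  by rewrite mulNr oppr_le0 divr_ge0 ?addr_ge0 ?sqr_ge0.
have : complex.Re z * h i <= 0 by rewrite ReS sumr_le0.
rewrite pmulr_lle0 // le_eqVlt => /orP[/eqP Rz|]; last by right.
left; move: ReS; rewrite Rz mul0r => /esym/eqP.
rewrite -oppr_eq0 -sumrN psumr_eq0 => [/allP S0|j /T0]; last by rewrite oppr_ge0.
(* When [Re z = 0], all terms [T j] vanish; by [Tle], a nonzero weight then forces [w j = w i]. So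
   row [i] of [Gamma w] is zero, and [Im z] vanishes as well. *)
have Gaj j : j != i -> Gamma i j * (a j 0 - a i 0) = 0 /\
    Gamma i j * (b j 0 - b i 0) = 0.
  move=> ji; have := S0 j (mem_index_enum _); rewrite ji oppr_eq0 mulf_eq0.
  have [->|] := eqVneq (Gamma i j) 0; first by rewrite !mul0r.
  move=> _ /eqP /= E; have := Tle j; rewrite E => le0.
  have : (a j 0 - a i 0) ^+ 2 + (b j 0 - b i 0) ^+ 2 == 0.
    by rewrite eq_le addr_ge0 ?sqr_ge0 // andbT; lra.
  rewrite paddr_eq0 ?sqr_ge0 // !sqrf_eq0 => /andP[/eqP-> /eqP->].
  by rewrite !mulr0.
have ImS : complex.Im z * h i = 0.
  transitivity (a i 0 * (Gamma *m b) i 0 - b i 0 * (Gamma *m a) i 0).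
    by rewrite Ga Gb !mxE /h; ring.
  rewrite !interconnection_mul !big1 ?mulr0 ?subr0 // => j /Gaj[] //.
move/eqP: ImS; rewrite mulf_eq0 (gt_eqF hi) orbF => /eqP Iz.
by apply/eqP; rewrite eq_complex Rz Iz eqxx.
Qed.

End Interconnection.

(** * Linear differential equations *)

Section Derivatives.
Context {R : realType}.

Lemma is_derive_sumf (I : finType) (F : I -> R -> R) (dF : I -> R) (t : R) :
  (forall i, is_derive t 1 (F i) (dF i)) ->
  is_derive t 1 (fun s => \sum_i F i s) (\sum_i dF i).
Proof.
move=> FdF.
have -> : (fun s => \sum_i F i s) = \sum_i F i.
  by apply/funext => s; rewrite fct_sumE.
elim/big_ind2 : _ => [|f df g dg fP gP|i _]; last exact: FdF.
- exact: is_derive_cst.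
- exact: is_deriveD.
Qed.

(** Derivatives are taken entrywise, so that products and transposes reduce to scalar rules. *)
Definition is_derive_mx (m n : nat) (t : R) (M : R -> 'M[R]_(m, n))
    (D : 'M[R]_(m, n)) :=
  forall i j, is_derive t 1 (fun s => M s i j) (D i j).

Lemma is_derive_mxP (m n : nat) (t : R) (M : R -> 'M[R]_(m, n)) D :
  is_derive t 1 M D -> is_derive_mx t M D.
Proof.
move=> [dM <-] i j; have /derivable_mxP dM' := dM.
by apply: DeriveDef; [exact: dM'|rewrite derive_mx // mxE].
Qed.

Lemma is_derive_mx_eq (m n : nat) (t : R) (M : R -> 'M[R]_(m, n)) D D' :
  is_derive_mx t M D -> D = D' -> is_derive_mx t M D'.
Proof. by move=> ? <-. Qed.

Lemma is_derive_mxB (m n : nat) (t : R) (M N : R -> 'M[R]_(m, n)) D E :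
  is_derive_mx t M D -> is_derive_mx t N E ->
  is_derive_mx t (fun s => M s - N s) (D - E).
Proof.
move=> MD NE i j; rewrite !mxE.
have -> : (fun s => (M s - N s) i j) = (fun s => M s i j) - (fun s => N s i j).
  by apply/funext => s; rewrite !mxE.
exact: is_deriveB.
Qed.

Lemma is_derive_mulmxl (m n k : nat) (t : R) (B : 'M[R]_(m, n))
    (M : R -> 'M[R]_(n, k)) D :
  is_derive_mx t M D -> is_derive_mx t (fun s => B *m M s) (B *m D).
Proof.
move=> MD i j; rewrite mxE.
have -> : (fun s => (B *m M s) i j) = (fun s => \sum_l B i l * M s l j).
  by apply/funext => s; rewrite mxE.
apply: is_derive_sumf => l.
have MDl := MD l j.
exact: (is_deriveZ (B i l)).
Qed.

Lemma is_derive_trmx (m n : nat) (t : R) (M : R -> 'M[R]_(m, n)) D :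
  is_derive_mx t M D -> is_derive_mx t (fun s => (M s)^T) D^T.
Proof.
move=> MD i j; rewrite mxE.
have -> : (fun s => (M s)^T i j) = (fun s => M s j i).
  by apply/funext => s; rewrite mxE.
exact: MD.
Qed.

Lemma is_derive_mulmxr (m n k : nat) (t : R) (B : 'M[R]_(n, k))
    (M : R -> 'M[R]_(m, n)) D :
  is_derive_mx t M D -> is_derive_mx t (fun s => M s *m B) (D *m B).
Proof.
move=> /is_derive_trmx/(is_derive_mulmxl B^T)/is_derive_trmx.
rewrite trmx_mul !trmxK => MD i j; have := MD i j.
by congr is_derive; apply/funext => s; rewrite trmx_mul !trmxK.
Qed.

Definition dot (n : nat) (u v : 'cV[R]_n) : R := (u^T *m v) 0 0.

Lemma dotE n (u v : 'cV[R]_n) : dot u v = \sum_i u i 0 * v i 0.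
Proof. by rewrite /dot mxE; apply: eq_bigr => i _; rewrite mxE. Qed.

Lemma dotC n (u v : 'cV[R]_n) : dot u v = dot v u.
Proof. by rewrite !dotE; apply: eq_bigr => i _; rewrite mulrC. Qed.

Lemma dotDr n (u v w : 'cV[R]_n) : dot u (v + w) = dot u v + dot u w.
Proof. by rewrite /dot mulmxDr mxE. Qed.

Lemma dotZr n (u v : 'cV[R]_n) c : dot u (c *: v) = c * dot u v.
Proof. by rewrite /dot -scalemxAr mxE. Qed.

Lemma dot_mull m n (M : 'M[R]_(m, n)) u v : dot (M *m u) v = dot u (M^T *m v).
Proof. by rewrite /dot trmx_mul mulmxA. Qed.

Lemma dotvv_ge0 n (v : 'cV[R]_n) : 0 <= dot v v.
Proof. by rewrite dotE sumr_ge0 // => i _; rewrite -expr2 sqr_ge0. Qed.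

Lemma dotvv_eq0 n (v : 'cV[R]_n) : (dot v v == 0) = (v == 0).
Proof.
apply/idP/eqP => [|->]; last by rewrite /dot mulmx0 mxE.
rewrite dotE psumr_eq0 => [/allP v0|i _]; last by rewrite -expr2 sqr_ge0.
apply/colP => i; apply/eqP; rewrite mxE -sqrf_eq0 expr2.
exact: (v0 i (mem_index_enum _)).
Qed.

Lemma dot_le n (u v : 'cV[R]_n) : 2 * `|dot u v| <= dot u u + dot v v.
Proof.
have p w : 2 * dot u w <= dot u u + dot w w.
  rewrite !dotE mulr_sumr -big_split /= ler_sum // => i _.
  by have := sqr_ge0 (u i 0 - w i 0); rewrite expr2; lra.
have := p v; have := p (- v).
have -> : dot u (- v) = - dot u v by rewrite -scaleN1r dotZr mulN1r.
have -> : dot (- v) (- v) = dot v v.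
  by rewrite -scaleN1r dotZr dotC dotZr mulrA mulrNN !mul1r.
by case: (ler0P (dot u v)) => _; lra.
Qed.

Lemma dot_CauchySchwarz n (u v : 'cV[R]_n) :
  dot u v ^+ 2 <= dot u u * dot v v.
Proof.
have [->|v0] := eqVneq v 0; first by rewrite /dot !mulmx0 !mxE mulr0 expr0n.
have vv : 0 < dot v v by rewrite lt_def dotvv_eq0 v0 dotvv_ge0.
(* This vector is [dot v v] times the component of [u] orthogonal to [v]. *)
have := dotvv_ge0 (dot v v *: u + (- dot u v) *: v).
rewrite dotDr !dotZr ![dot (_ + _) _]dotC !dotDr !dotZr (dotC v u).
set a := dot u u; set b := dot u v; set c := dot v v => h.
have : 0 <= c * (a * c - b ^+ 2) by rewrite expr2; nra.
by rewrite pmulr_rge0 // subr_ge0.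
Qed.

(** Cauchy-Schwarz on each row gives the squared Frobenius norm; the added 1 keeps [K] positive even
    for [M = 0]. *)
Lemma mulmx_dot_le m n (M : 'M[R]_(m, n)) :
  exists2 K, 0 < K & forall v, dot (M *m v) (M *m v) <= K * dot v v.
Proof.
pose r i := (row i M)^T.
exists (1 + \sum_i dot (r i) (r i)) => [|v].
  by rewrite ltr_pwDl // sumr_ge0 // => i _; exact: dotvv_ge0.
rewrite [leLHS]dotE mulrDl mul1r mulr_suml -[leLHS]add0r lerD ?dotvv_ge0 //.
apply: ler_sum => i _; rewrite -expr2.
suff -> : (M *m v) i 0 = dot (r i) v by exact: dot_CauchySchwarz.
by rewrite dotE mxE; apply: eq_bigr => j _; rewrite !mxE.
Qed.

Lemma is_derive_dot n (t : R) (u v : R -> 'cV[R]_n) du dv :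
  is_derive_mx t u du -> is_derive_mx t v dv ->
  is_derive t 1 (fun s => dot (u s) (v s)) (dot du (v t) + dot (u t) dv).
Proof.
move=> ud vd.
have -> : (fun s => dot (u s) (v s)) = (fun s => \sum_i u s i 0 * v s i 0).
  by apply/funext => s; rewrite dotE.
rewrite !dotE -big_split /=; apply: is_derive_sumf => i.
have ui := ud i 0; have vi := vd i 0.
apply: (is_derive_eq (is_deriveM ui vi)).
by rewrite /GRing.scale /= addrC; congr (_ + _); exact: mulrC.
Qed.

End Derivatives.

(** * Gronwall estimates and decay of Hurwitz systems *)

Section Decay.
Context {R : realType}.

Lemma nonincreasing_after (f f' : R -> R) (T : R) :
  (forall t : R, T < t -> is_derive t 1 f (f' t)) ->
  (forall t : R, T < t -> f' t <= 0) ->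
  {within `[T, +oo[, continuous f} ->
  forall t, T <= t -> f t <= f T.
Proof.
move=> df f'0 cf t Tt.
apply: (@ler0_derive1_nincry R f T) => // x; rewrite in_itv /= andbT => Tx.
- by have [] := df x Tx.
- by rewrite derive1E; have [_ ->] := df x Tx; exact: f'0.
Qed.

(** Integrating factor: a bound [df <= - a * (f t - c)] makes this derivative nonpositive. *)
Lemma is_derive_shifted_expR (f : R -> R) (a c df t : R) :
  is_derive t 1 f df ->
  is_derive t 1 (fun s => (f s - c) * expR (a * s))
    ((df + a * (f t - c)) * expR (a * t)).
Proof.
move=> fd.
have fcd : is_derive t 1 (fun s => f s - c) df.
  by apply: (is_derive_eq (is_deriveD fd (is_derive_cst (- c) t 1))); rewrite addr0.
have ed : is_derive t 1 (fun s => expR (a * s)) (expR (a * t) * a).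
  apply: is_derive1_comp.
  apply: (is_derive_eq (is_deriveZ a (is_derive_id t 1))).
  by rewrite /GRing.scale /= mulr1.
by apply: (is_derive_eq (is_deriveM fcd ed)); rewrite /GRing.scale /=; ring.
Qed.

(** Once [eps] stays below [a * (e / 2)], the product of [h t - e / 2] with [expR (a * t)] is
    nonincreasing, so [h] eventually falls below [e]. *)
Lemma decay (a : R) (h h' eps : R -> R) :
  0 < a ->
  (forall t : R, 0 < t -> is_derive t 1 h (h' t)) ->
  (forall t : R, 0 < t -> h' t <= - a * h t + eps t) ->
  (forall t : R, 0 <= h t) ->
  eps t @[t --> +oo] --> (0 : R) ->
  h t @[t --> +oo] --> (0 : R).
Proof.
move=> a0 dh h'le h0 eps0; apply/cvgr0Pnorm_le => e e0.
have d0 : 0 < e / 2 by rewrite divr_gt0.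
have [T [T0 epsT]] : exists T,
    0 < T /\ forall t : R, T < t -> eps t <= a * (e / 2).
  have /cvgr0Pnorm_le/(_ _ (mulr_gt0 a0 d0))[M [_ HM]] := eps0.
  exists (Num.max 1 M); split=> [|t]; first by rewrite lt_max ltr01.
  by rewrite gt_max => /andP[_ /HM]; exact: le_trans (ler_norm _).
pose k t := (h t - e / 2) * expR (a * t).
have kle (t : R) : T <= t -> k t <= k T.
  pose k' t := (h' t + a * (h t - e / 2)) * expR (a * t).
  have dk (s : R) : 0 < s -> is_derive s 1 k (k' s).
    by move=> s0; exact: is_derive_shifted_expR (dh s s0).
  apply: (@nonincreasing_after k k' T) => [s Ts|s Ts|].
  - by apply: dk; exact: lt_trans Ts.
  - rewrite mulr_le0_ge0 ?expR_ge0 //.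
    by have := h'le s (lt_trans T0 Ts); have := epsT s Ts; lra.
  - apply/continuous_in_subspaceT => s; rewrite inE /= in_itv /= andbT => Ts.
    apply/differentiable_continuous/derivable1_diffP.
    by have [] := dk s (lt_le_trans T0 Ts).
near=> t.
have Tt : T <= t by near: t; apply: nbhs_pinfty_ge; exact: num_real.
rewrite ger0_norm // (splitr e) -lerBlDr.
have := kle t Tt; rewrite /k -ler_pdivlMr ?expR_gt0 // -mulrA -expRN -expRD.
move=> /le_trans; apply.
(* From this time on, the bound [1 + x <= expR x] already brings the exponential term below
   [e / 2]. *)
have Kt : T + `|h T - e / 2| / (a * (e / 2)) <= t.
  by near: t; apply: nbhs_pinfty_ge; exact: num_real.
apply: (@le_trans _ _ (`|h T - e / 2| * expR (a * T - a * t))).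
  by rewrite ler_wpM2r ?expR_ge0 ?ler_norm.
rewrite -[a * T - _]opprB expRN ler_pdivrMr ?expR_gt0 //.
apply: (@le_trans _ _ (e / 2 * (1 + (a * t - a * T)))); last first.
  by rewrite ler_wpM2l ?(ltW d0) ?expR_ge1Dx.
rewrite -mulrBr mulrDr mulr1 -[leLHS]add0r lerD ?(ltW d0) //.
move: Kt; rewrite -lerBrDl ler_pdivrMr ?mulr_gt0 // => /le_trans; apply.
by rewrite [leRHS]mulrCA mulrA [leRHS]mulrC.
Unshelve. all: by end_near. Qed.

Lemma cvg_sqr0 (f : R -> R) (F : set_system R) {FF : Filter F} :
  f t ^+ 2 @[t --> F] --> (0 : R) -> f t @[t --> F] --> 0.
Proof.
move=> /cvgr0Pnorm_le f20; apply/cvgr0Pnorm_le => e e0.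
have := f20 _ (exprn_gt0 2 e0); apply: filterS => t.
by rewrite normrX ler_pXn2r // nnegrE ?normr_ge0 // ltW.
Qed.

Lemma sqr_cvg0 (f : R -> R) (F : set_system R) {FF : Filter F} :
  f t @[t --> F] --> (0 : R) -> f t ^+ 2 @[t --> F] --> 0.
Proof.
move=> f0; rewrite -[X in _ --> X](mulr0 (0 : R)).
by under eq_fun do rewrite expr2; exact: cvgM.
Qed.

Lemma cvg_sumr (I : finType) T (F : set_system T) {FF : Filter F}
    (f : I -> T -> R) (l : I -> R) :
  (forall i, f i x @[x --> F] --> l i) ->
  \sum_i f i x @[x --> F] --> \sum_i l i.
Proof. by move=> fl; apply: cvg_big => // x; exact: add_continuous. Qed.

(** Uniqueness by Gronwall: [2 * dot e (A e)] is at most [dot e e + dot (A e) (A e)], so the squared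
    norm grows at rate at most [1 + K], starting from 0. *)
Lemma linear_ode_zero n (A : 'M[R]_n) (e : R -> 'cV[R]_n) :
  (forall t : R, 0 < t -> is_derive_mx t e (A *m e t)) ->
  (forall i, {within `[0, +oo[, continuous (fun t => e t i 0)}) ->
  e 0 = 0 -> forall t : R, 0 <= t -> e t = 0.
Proof.
move=> de ce e0 t t0.
have [K K0 KA] := mulmx_dot_le A.
pose h s := dot (e s) (e s).
pose k s := (h s - 0) * expR (- (1 + K) * s).
have kle : k t <= k 0.
  pose h' s := dot (A *m e s) (e s) + dot (e s) (A *m e s).
  pose k' s := (h' s + - (1 + K) * (h s - 0)) * expR (- (1 + K) * s).
  apply: (@nonincreasing_after k k' 0) => // [s s0|s s0|].
  - by apply: is_derive_shifted_expR; apply: is_derive_dot; exact: de.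
  - rewrite mulr_le0_ge0 ?expR_ge0 // /h' [dot (A *m _) _]dotC.
    have := KA (e s); have := dot_le (e s) (A *m e s).
    by have := ler_norm (dot (e s) (A *m e s)); rewrite /h; lra.
  - move=> s; apply: cvgM; last first.
      apply: continuous_subspaceT => x; apply: continuous_comp.
        by apply: cvgM; [exact: cvg_cst|exact: cvg_id].
      exact: continuous_expR.
    apply: cvgB; last exact: cvg_cst.
    have -> : h = (fun s => \sum_i e s i 0 * e s i 0).
      by apply/funext => r; rewrite /h dotE.
    by apply: cvg_sumr => i; apply: cvgM; exact: ce.
apply/eqP; rewrite -dotvv_eq0 eq_le dotvv_ge0 andbT.
move: kle; rewrite /k /h e0 {2}/dot mulmx0 mxE !subr0 mul0r.
by rewrite pmulr_lle0 ?expR_gt0.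
Qed.

(* By Cayley-Hamilton, multiplying by the factors [N - z] one at a time kills
   every row [l]; each factor gives a scalar equation [f' = z f + g] in which
   [g] tends to zero by induction. *)
Lemma hurwitz_decay d (N : 'M[R]_d) (y : R -> 'cV[R]_d) :
  (forall z, eigenvalue (complexify N) z -> complex.Re z < 0) ->
  (forall t : R, 0 < t -> is_derive_mx t y (N *m y t)) ->
  forall i, y t i 0 @[t --> +oo] --> (0 : R).
Proof.
move=> HN dy i.
have [s sN s0] := annihilating_product (complexify N).
have {sN} sN : {in s, forall z, complex.Re z < 0} by move=> z /sN /HN.
pose h (l : 'rV[R[i]]_d) t :=
  (Re_mx l *m y t) 0 0 ^+ 2 + (Im_mx l *m y t) 0 0 ^+ 2.
have hP : forall l,
    l *m foldr (fun z B => (complexify N - z%:M) *m B) 1%:M s = 0 ->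
    h l t @[t --> +oo] --> (0 : R).
  elim: s sN {s0} => [_|z s IH zs] l /=.
    rewrite mulmx1 => ->; rewrite /h Re_mx0 Im_mx0.
    under eq_fun do rewrite mul0mx mxE expr0n addr0.
    exact: cvg_cst.
  rewrite mulmxA => /IH {}IH.
  have {}IH : h (l *m (complexify N - z%:M)) t @[t --> +oo] --> (0 : R).
    by apply: IH => x xs; apply: zs; rewrite in_cons xs orbT.
  have {zs} := zs z (mem_head _ _).
  set l1 := l *m _ in IH; set al := complex.Re z; set be := complex.Im z => al0.
  pose f t := (Re_mx l *m y t) 0 0; pose g t := (Im_mx l *m y t) 0 0.
  pose f1 t := (Re_mx l1 *m y t) 0 0; pose g1 t := (Im_mx l1 *m y t) 0 0.
  have El1 : l *m complexify N = z *: l + l1.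
    by rewrite /l1 mulmxBr mul_mx_scalar addrC subrK.
  have df (t : R) : 0 < t -> is_derive t 1 f (al * f t - be * g t + f1 t).
    move=> t0; have := is_derive_mulmxl (Re_mx l) (dy t t0) 0 0.
    congr is_derive; rewrite mulmxA.
    have -> : Re_mx l *m N = al *: Re_mx l - be *: Im_mx l + Re_mx l1.
      rewrite -Re_mxZ -Re_mxD -El1 Re_mx_mul Re_complexify Im_complexify.
      by rewrite mulmx0 subr0.
    by rewrite mulmxDl mulmxBl -!scalemxAl /f /g /f1 !mxE.
  have dg (t : R) : 0 < t -> is_derive t 1 g (be * f t + al * g t + g1 t).
    move=> t0; have := is_derive_mulmxl (Im_mx l) (dy t t0) 0 0.
    congr is_derive; rewrite mulmxA.
    have -> : Im_mx l *m N = be *: Re_mx l + al *: Im_mx l + Im_mx l1.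
      rewrite -Im_mxZ -Im_mxD -El1 Im_mx_mul Re_complexify Im_complexify.
      by rewrite mulmx0 addr0.
    by rewrite !mulmxDl -!scalemxAl /f /g /g1 !mxE.
  pose h' t := 2 * (f t * (al * f t - be * g t + f1 t)) +
               2 * (g t * (be * f t + al * g t + g1 t)).
  apply: (@decay (- al) (h l) h' (fun t => h l1 t / (- al))) => [|t t0|t t0|t|].
  - by rewrite oppr_gt0.
  - have fd := df t t0; have gd := dg t t0.
    apply: (is_derive_eq (is_deriveD (is_deriveX 2 fd) (is_deriveX 2 gd))).
    by rewrite /h' /GRing.scale /= !expr1; ring.
  (* The terms in [be] cancel in [h'], and completing the square absorbs the cross terms
     [f * f1 + g * g1]. *)
  - rewrite opprK -subr_ge0 (_ : _ - _ =
      ((al * f t + f1 t) ^+ 2 + (al * g t + g1 t) ^+ 2) / (- al)).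
      by rewrite divr_ge0 ?addr_ge0 ?sqr_ge0 // oppr_ge0 ltW.
    rewrite /h /h' -/(f t) -/(g t) -/(f1 t) -/(g1 t).
    by field; rewrite lt_eqF.
  - by rewrite addr_ge0 ?sqr_ge0.
  - rewrite -[X in _ --> X](mul0r (- al)^-1).
    by apply: cvgM IH _; exact: cvg_cst.
apply: cvg_sqr0.
have := hP (complexify (delta_mx 0 i)); rewrite s0 mulmx0 => /(_ erefl).
rewrite /h Re_complexify Im_complexify.
by under eq_fun do rewrite mul0mx -rowE !mxE expr0n addr0.
Qed.

End Decay.

(** * Matrix exponential *)

Section MatrixConvergence.
Context {R : realType} {T : Type} {F : set_system T} {FF : ProperFilter F}.

Lemma cvg_mxP m n (f : T -> 'M[R]_(m, n)) (l : 'M[R]_(m, n)) :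
  f x @[x --> F] --> l <-> forall i j, f x i j @[x --> F] --> l i j.
Proof.
split=> [fl i j|fl].
  exact: (cvg_comp f (fun M : 'M[R]_(m, n) => M i j) fl (@coord_continuous _ _ _ i j l)).
apply/cvgrPdist_le => e e0; near=> x.
rewrite /Num.Def.normr /= mx_normrE (bigmax_le _ (ltW e0)) //= => -[i j] _.
rewrite !mxE; move: i j; near: x.
apply: filter_forall => i; apply: filter_forall => j.
by have /cvgrPdist_le := fl i j; exact.
Unshelve. all: by end_near. Qed.

Lemma cvg_mulmxl m n k (B : 'M[R]_(m, n)) (f : T -> 'M[R]_(n, k))
    (l : 'M[R]_(n, k)) :
  f x @[x --> F] --> l -> B *m f x @[x --> F] --> B *m l.
Proof.
move=> /cvg_mxP fl; apply/cvg_mxP => i j; rewrite mxE.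
under eq_fun do rewrite mxE.
by apply: cvg_sumr => a; apply: cvgM; [exact: cvg_cst|exact: fl].
Qed.

Lemma cvg_trmx m n (f : T -> 'M[R]_(m, n)) (l : 'M[R]_(m, n)) :
  f x @[x --> F] --> l -> (f x)^T @[x --> F] --> l^T.
Proof.
move=> /cvg_mxP fl; apply/cvg_mxP => i j; rewrite mxE.
by under eq_fun do rewrite mxE; exact: fl.
Qed.

Lemma cvg_mulmxr m n k (B : 'M[R]_(n, k)) (f : T -> 'M[R]_(m, n))
    (l : 'M[R]_(m, n)) :
  f x @[x --> F] --> l -> f x *m B @[x --> F] --> l *m B.
Proof.
move=> /cvg_mxP fl; apply/cvg_mxP => i j; rewrite mxE.
under eq_fun do rewrite mxE.
by apply: cvg_sumr => a; apply: cvgM; [exact: fl|exact: cvg_cst].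
Qed.

Lemma cvg_mx_unique m n (f : T -> 'M[R]_(m, n)) (l l' : 'M[R]_(m, n)) :
  f x @[x --> F] --> l -> f x @[x --> F] --> l' -> l = l'.
Proof. by move=> fl fl'; rewrite -(cvg_lim _ fl) // -(cvg_lim _ fl'). Qed.

End MatrixConvergence.

Section MatrixExponential.
Context {R : realType} {n : nat}.
Implicit Types M : 'M[R]_n.

(** Power series coefficients of an entry of [M ^+ s *m expm (t *: M)]. The shift [s] makes the
    family stable under formal differentiation, which raises [s] by one. *)
Definition expm_coeff M (s : nat) i j (k : nat) : R :=
  k`!%:R^-1 * (M ^+ (k + s)) i j.

Lemma expmx_entry_le M k i j :
  `|(M ^+ k) i j| <= (1 + \sum_i \sum_j `|M i j|) ^+ k.
Proof.
set S := \sum_i _; have S0 : 0 <= S by apply: sumr_ge0 => a _; exact: sumr_ge0.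
elim: k i j => [|k IH] i j.
  by rewrite !expr0 mxE; case: eqP => _; rewrite ?normr1 ?normr0.
rewrite !exprS mxE (le_trans (ler_norm_sum _ _ _)) //.
apply: (@le_trans _ _ (\sum_a `|M i a| * (1 + S) ^+ k)).
  by apply: ler_sum => a _; rewrite normrM ler_wpM2l.
rewrite -mulr_suml ler_wpM2r ?exprn_ge0 ?addr_ge0 //.
apply: ler_wpDl => //; rewrite /S [leRHS](bigD1 i) //= lerDl.
by apply: sumr_ge0 => b _; exact: sumr_ge0.
Qed.

(** The terms are dominated by [S ^+ s] times those of the exponential series at [S * |x|]. *)
Lemma is_cvg_expm_coeff M s i j x : cvgn (pseries (expm_coeff M s i j) x).
Proof.
apply: normed_cvg; set S := 1 + \sum_i \sum_j `|M i j|.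
have S0 : 0 <= S by rewrite addr_ge0 // sumr_ge0 // => a _; exact: sumr_ge0.
have cv : cvgn (series (fun k => S ^+ s * exp_coeff (S * `|x|) k)).
  by apply: is_cvg_seriesZ; exact: is_cvg_series_exp_coeff.
apply: series_le_cvg cv => k; first exact: normr_ge0.
  by rewrite mulr_ge0 ?exprn_ge0 // exp_coeff_ge0 // mulr_ge0.
rewrite /expm_coeff /exp_coeff /= !normrM normrX normfV.
rewrite (ger0_norm (ler0n _ _)) exprMn.
have := expmx_entry_le M (k + s) i j; rewrite -/S => le.
apply: (@le_trans _ _ (k`!%:R^-1 * (S ^+ k * S ^+ s) * `|x| ^+ k)).
  by rewrite ler_wpM2r ?exprn_ge0 // ler_wpM2l ?invr_ge0 // -(exprD S).
move: (S ^+ k) (S ^+ s) (`|x| ^+ k) (k`!%:R^-1 : R) => a b c d.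
by rewrite (_ : d * (a * b) * c = b * (a * c * d)) //; ring.
Qed.

Lemma exprZmx (t : R) M k : (t *: M) ^+ k = t ^+ k *: M ^+ k.
Proof.
elim: k => [|k IH]; first by rewrite !expr0 scale1r.
rewrite !exprS IH; rewrite -[LHS]/((t *: M) *m (t ^+ k *: M ^+ k)).
by rewrite -scalemxAl -scalemxAr scalerA.
Qed.

Definition expm_partial M (N : nat) (t : R) : 'M[R]_n :=
  \sum_(k < N) k`!%:R^-1 *: (t ^+ k *: M ^+ k).

Lemma expm_partialE M s t N i j :
  (M ^+ s *m expm_partial M N t) i j = pseries (expm_coeff M s i j) t N.
Proof.
rewrite /pseries /series /= big_mkord mulmx_sumr summxE.
apply: eq_bigr => k _; rewrite -!scalemxAr !mxE /expm_coeff addnC exprD.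
rewrite (_ : M ^+ s * M ^+ k = M ^+ s *m M ^+ k) // mxE.
by rewrite -[RHS]mulrA [_ * t ^+ k]mulrC.
Qed.

Lemma cvg_expm M (t : R) : expm_partial M N t @[N --> \oo] --> expm (t *: M).
Proof.
have -> : expm (t *: M) = limn (fun N => expm_partial M N t).
  rewrite /expm; congr (limn _); apply/funext => N.
  rewrite /series /= big_mkord; apply: eq_bigr => k _.
  by rewrite exprZmx.
suff: cvgn (fun N => expm_partial M N t) by [].
apply/cvg_ex; exists (\matrix_(i, j) limn (pseries (expm_coeff M 0 i j) t)).
apply/cvg_mxP => i j; rewrite mxE.
have -> : (fun N => expm_partial M N t i j) = pseries (expm_coeff M 0 i j) t.
  by apply/funext => N; rewrite -expm_partialE expr0 mul1mx.
exact: is_cvg_expm_coeff.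
Qed.

Lemma expmE M s (t : R) i j :
  (M ^+ s *m expm (t *: M)) i j = limn (pseries (expm_coeff M s i j) t).
Proof.
apply/esym/cvg_lim => //.
have -> : pseries (expm_coeff M s i j) t =
    (fun N => (M ^+ s *m expm_partial M N t) i j).
  by apply/funext => N; rewrite expm_partialE.
exact: ((cvg_mxP _ _).1 (cvg_mulmxl (B := M ^+ s) (@cvg_expm M t)) i j).
Qed.

Lemma pseries_diffs_expm_coeff M s i j :
  pseries_diffs (expm_coeff M s i j) = expm_coeff M s.+1 i j.
Proof.
apply/funext => k; rewrite /pseries_diffs /expm_coeff addnS addSn mulrA; congr (_ * _).
by rewrite factS natrM invfM mulVKf.
Qed.

Lemma is_derive_expm M (t : R) :
  is_derive_mx t (fun s => expm (s *: M)) (M *m expm (t *: M)).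
Proof.
move=> i j.
have -> : (fun s => expm (s *: M) i j) =
    (fun s => limn (pseries (expm_coeff M 0 i j) s)).
  by apply/funext => s; rewrite -expmE expr0 mul1mx.
have -> : (M *m expm (t *: M)) i j =
    limn (pseries (pseries_diffs (expm_coeff M 0 i j)) t).
  by rewrite pseries_diffs_expm_coeff -expmE expr1.
(* Termwise differentiation at [t] needs convergence at a larger radius. The series and its formal
   derivatives converge everywhere, so [|t| + 1] will do. *)
apply: (@pseries_snd_diffs _ _ (`|t| + 1)); rewrite ?pseries_diffs_expm_coeff.
- exact: is_cvg_expm_coeff.
- exact: is_cvg_expm_coeff.
- exact: is_cvg_expm_coeff.
- by rewrite [ltRHS]ger0_norm ?addr_ge0 // ltrDl.
Qed.

Lemma expm_partial0 M N : (0 < N)%N -> expm_partial M N 0 = 1%:M.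
Proof.
case: N => // N _; rewrite /expm_partial big_ord_recl big1 => [|k _].
  by rewrite expr0 fact0 invr1 !scale1r addr0.
by rewrite expr0n /= scale0r scaler0.
Qed.

Lemma expm0 M : expm (0 *: M) = 1%:M.
Proof.
apply: (cvg_mx_unique (@cvg_expm M 0)); apply: cvg_near_cst.
(* The partial sum with no terms is 0; from one term on, the sequence is constantly the identity. *)
by exists 1%N => // N N0; rewrite /= expm_partial0.
Qed.

Lemma expm_comm M (t : R) : M *m expm (t *: M) = expm (t *: M) *m M.
Proof.
apply: (cvg_mx_unique (cvg_mulmxl (B := M) (@cvg_expm M t))).
have -> : (fun N => M *m expm_partial M N t) = (fun N => expm_partial M N t *m M).
  apply/funext => N; rewrite /expm_partial mulmx_sumr mulmx_suml.
  apply: eq_bigr => k _; rewrite -!scalemxAr -!scalemxAl.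
  by rewrite -[M *m _]/(M * _) -[_ *m M]/(_ * M) -exprS exprSr.
exact: cvg_mulmxr (@cvg_expm M t).
Qed.

Lemma expm_trmx M (t : R) : expm (t *: M^T) = (expm (t *: M))^T.
Proof.
apply: (cvg_mx_unique (@cvg_expm M^T t)).
have -> : (fun N => expm_partial M^T N t) = (fun N => (expm_partial M N t)^T).
  apply/funext => N; rewrite /expm_partial linear_sum /=.
  apply: eq_bigr => k _.
  suff -> : M^T ^+ k = (M ^+ k)^T by apply/matrixP => a b; rewrite !mxE.
  elim: (val k) => [|l IH]; first by rewrite !expr0; exact/esym/trmx1.
  by rewrite exprS exprSr IH -[LHS]/(_ *m _) -trmx_mul.
exact: cvg_trmx (@cvg_expm M t).
Qed.

Lemma expm_annihilated m (C : 'M[R]_(m, n)) M p (x : 'M[R]_(n, p)) :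
  (forall k, C *m M ^+ k *m x = 0) -> forall t : R, C *m expm (t *: M) *m x = 0.
Proof.
move=> CMx t.
apply: (cvg_mx_unique (cvg_mulmxr (B := x) (cvg_mulmxl (B := C) (@cvg_expm M t)))).
have -> : (fun N => C *m expm_partial M N t *m x) = (fun=> 0).
  apply/funext => N; rewrite /expm_partial mulmx_sumr mulmx_suml big1 // => k _.
  by rewrite -!scalemxAr -!scalemxAl CMx !scaler0.
exact: cvg_cst.
Qed.

End MatrixExponential.

(** * Imaginary part of a neutrally stable matrix *)

Section ImaginaryPart.
Context {R : realType}.

Lemma jordan_block1 (K : fieldType) k (lam : K) :
  k = 1%N -> jordan_block k lam = lam%:M.
Proof.
move=> k1; apply/matrixP => i j; rewrite !mxE.
rewrite (_ : (i.+1 == j :> nat) = false) ?addr0 ?mulr_natl //.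
by have := ltn_ord j; rewrite {2}k1; case: (val j).
Qed.

(** Read from the last row up: once the rows below row [i] vanish, the equation would make a nonzero
    row [i] a left eigenvector of [M] for [lam]. *)
Lemma jordan_block_sylvester (K : fieldType) k n (lam : K) (M : 'M[K]_n)
    (X : 'M[K]_(k, n)) :
  X *m M = jordan_block k lam *m X -> ~~ eigenvalue M lam -> X = 0.
Proof.
move=> XM lamP.
suff X0 m : forall i : 'I_k, (k - i <= m)%N -> row i X = 0.
  by apply/row_matrixP => i; rewrite row0 (X0 k) // leq_subr.
elim: m => [|m IH] i im.
  by move: im; rewrite leqn0 subn_eq0 leqNgt ltn_ord.
have XMi : row i X *m M = lam *: row i X.
  rewrite -row_mul XM row_mul; apply/rowP => j; rewrite !mxE.
  rewrite (bigD1 i) //= !mxE eqxx mul1r gtn_eqF // addr0 big1 ?addr0 // => l li.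
  rewrite !mxE eq_sym (negbTE li) mul0r add0r.
  case: eqP => [il|_]; last by rewrite mul0r.
  have /rowP/(_ j) : row l X = 0.
    by apply: IH; rewrite -il subnS -subn1 leq_subLR add1n.
  by rewrite !mxE => ->; rewrite mulr0.
apply/eqP; apply: contraNT lamP => Xi0.
by apply/eigenvalueP; exists (row i X).
Qed.

(* The rows of [T *m U] of a Jordan block off the imaginary axis vanish, the
   others are left eigenvectors of [F]; [Z] lists their real and imaginary
   parts. *)
Lemma imaginary_part_isometry n n1 (A : 'M[R]_n) (F : 'M[R]_n1)
    (U : 'M[R]_(n, n1)) (V1 : 'M[R]_(n1, n)) :
  neutrally_stable A -> A *m U = U *m F -> V1 *m U = 1%:M ->
  (forall z, eigenvalue (complexify F) z -> complex.Re z = 0) ->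
  exists k (Z : 'M[R]_(k, n1)) (W : 'M[R]_k) (Y : 'M[R]_(n1, k)),
    [/\ Z *m F = W *m Z, W^T = - W & Y *m Z = 1%:M].
Proof.
move=> [_ [N [size [lam [[_ [S [T [[ST TS] TAS]]]] lamP]]]]] AU VU FP.
pose L := T *m complexify U.
have LF : L *m complexify F = (\mxdiag_b jordan_block (size b) (lam b)) *m L.
  rewrite -TAS /L -!mulmxA -complexifyM -AU complexifyM; congr (_ *m _).
  by rewrite (mulmxA S) ST mul1mx.
have VSL : (complexify V1 *m S) *m L = 1%:M.
  rewrite /L -mulmxA (mulmxA S) ST mul1mx -complexifyM VU.
  exact: complexify1.
clearbody L; pose Lb b := submxcol L b.
have LbF b : Lb b *m complexify F = jordan_block (size b) (lam b) *m Lb b.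
  rewrite /Lb submxcol_mul LF -{1}(submxcolK L) mul_mxdiag_mxcol.
  by rewrite mxcolK.
(* On the axis, blocks have size one and [lam b] is purely imaginary; off it, [Lb b] vanishes
   because [lam b] is not an eigenvalue of [F]. One formula covers both cases. *)
have LbE b : Lb b *m complexify F = Complex 0 (complex.Im (lam b)) *: Lb b.
  have [/eqP re0|re0] := boolP (complex.Re (lam b) == 0).
    rewrite LbF jordan_block1 ?lamP // mul_scalar_mx; congr (_ *: _).
    by move: re0; case: (lam b) => a c /= ->.
  rewrite (jordan_block_sylvester (LbF b)) ?mul0mx ?scaler0 //.
  by apply: contraNN re0 => /FP ->.
pose D : 'M[R]_(\sum_b size b) :=
  diag_mx (\row_s complex.Im (lam (tagnat.sig1 s))).
have LFE : L *m complexify F = Complex 0 1 *: (complexify D *m L).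
  apply/matrixP => s j.
  have -> : (L *m complexify F) s j = (\mxcol_b (Lb b *m complexify F)) s j.
    by rewrite -mxcol_mul (submxcolK L).
  rewrite (_ : \mxcol_b _ = \mxcol_b (Complex 0 (complex.Im (lam b)) *: Lb b)).
    rewrite /complexify map_diag_mx mul_diag_mx -[in RHS](submxcolK L) !mxE mulrA.
    congr (_ * _).
    apply/eqP; rewrite eq_complex /=.
    by rewrite !(mul0r, mul1r, mulr0, subr0, add0r, addr0, oppr0) !eqxx.
  by apply: eq_mxcol => b; exact: LbE.
(* Taking real and imaginary parts of [L F = i D L] gives [Re L F = - D Im L] and [Im L F = D Re L],
   hence the skew block matrix. The left inverse is the real part of [(V1 S) L = 1]. *)
exists ((\sum_b size b) + \sum_b size b)%N, (col_mx (Re_mx L) (Im_mx L)),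
  (block_mx 0 (- D) D 0), (row_mx (Re_mx (complexify V1 *m S))
    (- Im_mx (complexify V1 *m S))); split.
- rewrite mul_col_mx mul_block_col !mul0mx add0r addr0 mulNmx.
  congr col_mx.
    have := congr1 (@Re_mx R _ _) LFE.
    rewrite Re_mx_mul Re_complexify Im_complexify mulmx0 subr0 => ->.
    by rewrite Re_mxZ /= scale0r scale1r sub0r Im_mul_real.
  have := congr1 (@Im_mx R _ _) LFE.
  rewrite Im_mx_mul Re_complexify Im_complexify mulmx0 addr0 => ->.
  by rewrite Im_mxZ /= scale0r scale1r addr0 Re_mul_real.
- rewrite tr_block_mx !trmx0 linearN /= tr_diag_mx.
  by rewrite opp_block_mx !oppr0 opprK.
- rewrite mul_row_col mulNmx -Re_mx_mul VSL.
  by rewrite -(complexify1 (R := R)) Re_complexify.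
Qed.

End ImaginaryPart.

(** * The averaged Gram matrix and its quadratic form *)

Section GramAverage.
Context {R : realType} {n k : nat} (F : 'M[R]_n).
Context (Z : 'M[R]_(k, n)) (W : 'M[R]_k) (Y : 'M[R]_(n, k)).
Hypotheses (ZF : Z *m F = W *m Z) (W_skew : W^T = - W) (YZ : Y *m Z = 1%:M).

Local Notation E t := (expm (t *: F)).
Local Notation mu := (@lebesgue_measure R).

Lemma is_derive_flow (v : 'cV[R]_n) (t : R) :
  is_derive_mx t (fun s => E s *m v) (F *m (E t *m v)).
Proof. by rewrite mulmxA; apply: is_derive_mulmxr; exact: is_derive_expm. Qed.

(* [Z] conjugates the flow of [F] to a flow of isometries, so [|e^(tF) v|^2] is
   bounded above and away from zero. *)
Lemma flow_isometry (v : 'cV[R]_n) (t : R) :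
  dot (Z *m (E t *m v)) (Z *m (E t *m v)) = dot (Z *m v) (Z *m v).
Proof.
pose f s := dot (Z *m (E s *m v)) (Z *m (E s *m v)).
have -> : dot (Z *m v) (Z *m v) = f 0 by rewrite /f expm0 mul1mx.
apply: is_derive_0_is_cst => s.
have dZ := is_derive_mulmxl Z (is_derive_flow v s).
apply: (is_derive_eq (is_derive_dot dZ dZ)).
rewrite mulmxA ZF -mulmxA.
by rewrite dot_mull W_skew mulNmx -scaleN1r dotZr mulN1r addNr.
Qed.

Lemma continuous_flow_dot (u v : 'cV[R]_n) :
  continuous (fun t : R => dot (E t *m u) (E t *m v)).
Proof.
move=> t; apply/differentiable_continuous/derivable1_diffP.
by have [] := is_derive_dot (is_derive_flow u t) (is_derive_flow v t).
Qed.

Lemma continuous_integrable (f : R -> R) (t : R) :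
  continuous f -> mu.-integrable `[0, t] (EFin \o f).
Proof.
move=> cf; apply: continuous_compact_integrable; first exact: segment_compact.
exact: continuous_subspaceT.
Qed.

Lemma Rintegral_sum (I : Type) (s : seq I) (c : I -> R) (f : I -> R -> R)
    (t : R) :
  (forall i, continuous (f i)) ->
  \int[mu]_(x in `[0, t]) (\sum_(i <- s) c i * f i x) =
  \sum_(i <- s) c i * \int[mu]_(x in `[0, t]) f i x.
Proof.
move=> cf; elim: s => [|i s IH].
  rewrite big_nil; under eq_Rintegral do rewrite big_nil.
  by rewrite Rintegral_cst // mul0r.
rewrite big_cons -IH; under eq_Rintegral do rewrite big_cons.
have cif j : continuous (fun x => c j * f j x).
  by move=> x; apply: cvgM; [exact: cvg_cst|exact: cf].
rewrite RintegralD //.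
- by rewrite RintegralZl //; exact: continuous_integrable.
- exact: continuous_integrable.
- apply: continuous_integrable => x; apply: cvg_big => [|j _]; last exact: cif.
  by move=> ?; exact: add_continuous.
Qed.

(** Turns symmetry, positivity and skewness of the limit into statements about scalar time averages
    along the flow. *)
Lemma gram_averageE (u v : 'cV[R]_n) (t : R) :
  dot u (gram_average F t *m v) =
  t^-1 * \int[mu]_(x in `[0, t]) dot (E x *m u) (E x *m v).
Proof.
rewrite /gram_average -scalemxAl dotZr; congr (_ * _).
pose g (ij : 'I_n * 'I_n) x : R := ((E x)^T *m E x) ij.1 ij.2.
pose c (ij : 'I_n * 'I_n) : R := u ij.1 0 * v ij.2 0.
have gE ij x : g ij x = dot (E x *m delta_mx ij.1 0) (E x *m delta_mx ij.2 0).
  rewrite /dot trmx_mul trmx_delta -mulmxA (mulmxA (E x)^T) mulmxA -rowE.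
  by rewrite /g -colE !mxE.
have cg ij : continuous (g ij).
  rewrite (_ : g ij = fun x => dot (E x *m delta_mx ij.1 0) (E x *m delta_mx ij.2 0)).
    exact: continuous_flow_dot.
  by apply/funext => x; rewrite gE.
transitivity (\int[mu]_(x in `[0, t]) (\sum_ij c ij * g ij x)).
  rewrite Rintegral_sum //.
  rewrite dotE; under eq_bigr => i _ do rewrite mxE mulr_sumr.
  rewrite pair_big /=; apply: eq_bigr => ij _; rewrite !mxE /c /g.
  rewrite [RHS]mulrAC -mulrA; congr (_ * (_ * _)).
  by apply: eq_Rintegral => x _; rewrite expm_trmx.
apply: eq_Rintegral => x _.
rewrite /dot trmx_mul -mulmxA (mulmxA (E x)^T) mxE.
under [RHS]eq_bigr => j _ do rewrite mxE [X in _ * X]mxE mulr_sumr.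
rewrite pair_big /=; apply: eq_bigr => ij _.
by rewrite /c /g -mulrA; congr (_ * _); exact: mulrC.
Qed.

Context (P : 'M[R]_n).
Hypothesis gramP : gram_average F t @[t --> +oo] --> P.

Lemma cvg_gram_dot (u v : 'cV[R]_n) :
  dot u (gram_average F t *m v) @[t --> +oo] --> dot u (P *m v).
Proof.
have := (cvg_mxP _ _).1 (cvg_mulmxl (B := u^T) (cvg_mulmxr (B := v) gramP)) 0 0.
exact.
Qed.

Lemma gram_limit_sym (u v : 'cV[R]_n) : dot u (P *m v) = dot v (P *m u).
Proof.
have E : (fun t => dot u (gram_average F t *m v)) =
    (fun t => dot v (gram_average F t *m u)).
  apply/funext => t; rewrite !gram_averageE.
  by congr (_ * _); apply: eq_Rintegral => x _; rewrite dotC.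
rewrite -(cvg_lim _ (cvg_gram_dot (u := u) (v := v))) // E.
exact: cvg_lim (cvg_gram_dot (u := v) (v := u)).
Qed.

(** The integrand [|e^(tF) v|^2] is at least [|Z e^(tF) v|^2 / K = |Z v|^2 / K], a positive constant
    because [Z] has a left inverse. *)
Lemma gram_limit_gt0 (v : 'cV[R]_n) : v != 0 -> 0 < dot v (P *m v).
Proof.
move=> v0; have [K K0 KZ] := mulmx_dot_le Z.
have Zv0 : Z *m v != 0.
  by apply: contraNneq v0 => Zv; rewrite -(mul1mx v) -YZ -mulmxA Zv mulmx0.
have c0 : 0 < dot (Z *m v) (Z *m v) / K.
  by rewrite divr_gt0 // lt_neqAle eq_sym dotvv_eq0 Zv0 dotvv_ge0.
apply: lt_le_trans c0 _.
apply: (cvgr_to_ge (cvg_gram_dot (u := v) (v := v))).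
near=> t.
have t0 : 0 < t by near: t; apply: nbhs_pinfty_gt; exact: num_real.
rewrite gram_averageE [leRHS]mulrC ler_pdivlMr //.
have -> : dot (Z *m v) (Z *m v) / K * t =
    \int[mu]_(x in `[0, t]) (dot (Z *m v) (Z *m v) / K).
  rewrite (@Rintegral_cst _ _ _ mu `[0, t]%classic) //= lebesgue_measure_itv /= lte_fin t0 /=.
  by rewrite subr0.
apply: le_Rintegral => // [||x _].
- by apply: continuous_integrable => x; exact: cvg_cst.
- by apply: continuous_integrable; exact: continuous_flow_dot.
- by rewrite ler_pdivrMr // mulrC -(flow_isometry v x).
Unshelve. all: by end_near. Qed.

(** The integrand is the derivative of [N / 2], where [N] is bounded because the flow is isometric
    in [Z] and [Y] inverts [Z] on the left. The averages are therefore of order [t^-1]. *)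
Lemma gram_limit_skew (v : 'cV[R]_n) : dot v (P *m (F *m v)) = 0.
Proof.
have [K K0 KY] := mulmx_dot_le Y.
pose N s := dot (E s *m v) (E s *m v).
have NK s : N s <= K * dot (Z *m v) (Z *m v).
  rewrite /N -(flow_isometry v s) -{1 2}(mul1mx (E s *m v)) -YZ -mulmxA.
  exact: KY.
have dN (s : R) : is_derive s 1 (fun r => N r / 2)
    (dot (E s *m v) (E s *m (F *m v))).
  have dE := is_derive_flow v s; have dNs := is_derive_dot dE dE.
  have -> : (fun r => N r / 2) =
    (fun r => dot (E r *m v) (E r *m v)) * cst (2^-1) by [].
  apply: (is_derive_eq (is_deriveM dNs (is_derive_cst (2^-1 : R) s (1 : R)))).
  rewrite /GRing.scale /= mulr0 add0r [dot (F *m _) _]dotC.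
  by rewrite (mulmxA F) expm_comm -mulmxA; field.
suff h : dot v (gram_average F t *m (F *m v)) @[t --> +oo] --> (0 : R).
  by rewrite -(cvg_lim _ (cvg_gram_dot (u := v) (v := F *m v))) // (cvg_lim _ h).
set C := K * dot (Z *m v) (Z *m v) in NK.
have C0 : 0 <= C by apply: le_trans (NK 0); exact: dotvv_ge0.
apply/cvgr0Pnorm_le => e e0; near=> t.
have t0 : 0 < t by near: t; apply: nbhs_pinfty_gt; exact: num_real.
have te : C / e <= t by near: t; apply: nbhs_pinfty_ge; exact: num_real.
rewrite gram_averageE.
have -> : \int[mu]_(x in `[0, t]) dot (E x *m v) (E x *m (F *m v)) =
    N t / 2 - N 0 / 2.
  rewrite /Rintegral (@continuous_FTC2 _ _ (fun r => N r / 2)) //.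
  - by apply: continuous_subspaceT; exact: continuous_flow_dot.
  - have cN : continuous (fun r => N r / 2).
      by move=> s; apply/differentiable_continuous/derivable1_diffP; have [] := dN s.
    split=> [s _||]; first by have [] := dN s.
    + exact/cvg_at_right_filter/cN.
    + exact/cvg_at_left_filter/cN.
  - by move=> s _; rewrite derive1E; have [_ ->] := dN s.
rewrite normrM gtr0_norm ?invr_gt0 // mulrC ler_pdivrMr //.
have Cet : C <= e * t by rewrite mulrC -ler_pdivrMr.
have N0 s : 0 <= N s by exact: dotvv_ge0.
have := N0 t; have := N0 0; have := NK t; have := NK 0.
by rewrite ler_norml => *; apply/andP; split; lra.
Unshelve. all: by end_near. Qed.

End GramAverage.

(** * Eigenvalues of [A + la L C] *)

Section CoupledEigenvalue.
Context {R : realType}.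

Lemma cvg_dotvv0 n T (F : set_system T) {FF : ProperFilter F}
    (f : T -> 'cV[R]_n) :
  f t @[t --> F] --> (0 : 'cV[R]_n) -> dot (f t) (f t) @[t --> F] --> (0 : R).
Proof.
move=> f0; have f0i i := (cvg_mxP _ _).1 f0 i 0.
have -> : (fun t => dot (f t) (f t)) = (fun t => \sum_i f t i 0 * f t i 0).
  by apply/funext => t; rewrite dotE.
have := cvg_sumr (fun i => cvgM (f0i FF i) (f0i FF i)).
by rewrite -dotE /dot mulmx0 mxE; exact.
Qed.

Lemma size_eigenvalues n (A : 'M[R]_n) : seq.size (eigenvalues A) = n.
Proof.
have := size_char_poly (complexify A).
by rewrite char_poly_eigenvalues size_prod_XsubC => -[].
Qed.

Lemma perm_eigenvalues_block n n1 n2 (A : 'M[R]_n) (F : 'M[R]_n1) (G : 'M[R]_n2)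
    (S : 'M[R]_(n, n1 + n2)) (V : 'M[R]_(n1 + n2, n)) :
  mutual_inverse S V -> V *m A *m S = block_mx F 0 0 G ->
  perm_eq (eigenvalues A) (eigenvalues F ++ eigenvalues G).
Proof.
move=> [SV VS] VAS; apply: prod_XsubC_eq.
rewrite big_cat /= -!char_poly_eigenvalues.
rewrite (@char_poly_similar _ _ _ _
  (block_mx (complexify F) 0 0 (complexify G)) (complexify S) (complexify V)).
- by rewrite /char_poly char_block_diag_mx det_ublock.
- by split; rewrite -complexifyM ?SV ?VS complexify1.
- rewrite -!complexifyM VAS /complexify map_block_mx.
  by rewrite !map_mx0.
Qed.

Lemma posdef_unitmx n (P : 'M[R]_n) :
  (forall v, v != 0 -> 0 < dot v (P *m v)) -> P \in unitmx.
Proof.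
move=> P0; rewrite unitmxE unitfE; apply/det0P => -[v v0 vP].
have := P0 v^T; rewrite trmx_eq0 => /(_ v0).
by rewrite /dot trmxK mulmxA vP mul0mx mxE ltxx.
Qed.

Lemma expm_intertwine n n1 (A : 'M[R]_n) (F : 'M[R]_n1) (U : 'M[R]_(n, n1))
    (V1 : 'M[R]_(n1, n)) (t : R) :
  A *m U = U *m F -> V1 *m U = 1%:M ->
  V1 *m expm (t *: A) *m U = expm (t *: F).
Proof.
move=> AU VU.
apply: (cvg_mx_unique (cvg_mulmxr (B := U) (cvg_mulmxl (B := V1) (@cvg_expm _ _ A t)))).
have -> : (fun N => V1 *m expm_partial A N t *m U) = (fun N => expm_partial F N t).
  apply/funext => N; rewrite /expm_partial mulmx_sumr mulmx_suml.
  apply: eq_bigr => k _; rewrite -!scalemxAr -!scalemxAl; congr (_ *: (_ *: _)).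
  elim: (val k) => [|l IH].
    by rewrite !expr0 -[1 in LHS]/(1%:M) mulmx1 VU.
  rewrite !exprSr -[_ * A]/(_ *m A) -[_ * F]/(_ *m F).
  by rewrite (mulmxA V1) -(mulmxA _ A) AU mulmxA IH.
exact: cvg_expm.
Qed.

Section Algorithm.
Context {n m : nat} (A : 'M[R]_n) (C : 'M[R]_(m, n)) (L : 'M[R]_(n, m)).
Hypotheses (As : neutrally_stable A) (CA : detectable C A).

(** Detectability makes the trajectory of [A] from [U a] tend to zero. In the coordinates [Z] that
    trajectory keeps a constant norm, so [Z a = 0]. *)
Lemma observable_zero n1 (F : 'M[R]_n1) (U : 'M[R]_(n, n1)) (V1 : 'M[R]_(n1, n))
    k (Z : 'M[R]_(k, n1)) (W : 'M[R]_k) (Y : 'M[R]_(n1, k)) (a : 'cV[R]_n1) :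
  A *m U = U *m F -> V1 *m U = 1%:M ->
  Z *m F = W *m Z -> W^T = - W -> Y *m Z = 1%:M ->
  (forall l, C *m U *m F ^+ l *m a = 0) -> a = 0.
Proof.
move=> AU VU ZF Wskew YZ CFa.
have AUk l : A ^+ l *m U = U *m F ^+ l.
  elim: l => [|l IH]; first by rewrite !expr0 mulmx1 mul1mx.
  rewrite exprSr exprS -[_ * A]/(_ *m A) -[F * _]/(F *m _).
  by rewrite -mulmxA AU mulmxA IH -mulmxA -[F ^+ l *m F]/(_ * _) -exprSr exprS.
have Ua0 : expm (t *: A) *m (U *m a) @[t --> +oo] --> (0 : 'cV[R]_n).
  apply: CA => t t0; apply: expm_annihilated => l.
  by rewrite mulmxA -(mulmxA C) AUk mulmxA CFa.
have E t : expm (t *: F) *m a = V1 *m (expm (t *: A) *m (U *m a)).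
  by rewrite -(expm_intertwine t AU VU) !mulmxA.
have Za0 : dot (Z *m a) (Z *m a) = 0.
  have c1 : dot (Z *m (expm (t *: F) *m a)) (Z *m (expm (t *: F) *m a))
      @[t --> +oo] --> (0 : R).
    under eq_fun do rewrite E.
    apply: cvg_dotvv0; rewrite -[X in _ --> X](mulmx0 _ Z).
    apply: cvg_mulmxl; rewrite -[X in _ --> X](mulmx0 _ V1).
    exact: cvg_mulmxl.
  rewrite -(cvg_lim _ c1) //.
  under eq_fun do rewrite (flow_isometry ZF Wskew).
  by apply/esym/cvg_lim => //; exact: cvg_cst.
have /eqP : Z *m a = 0 by apply/eqP; rewrite -dotvv_eq0 Za0.
by move=> /eqP Za; rewrite -(mul1mx a) -YZ -mulmxA Za mulmx0.
Qed.

(** The equation on [v] is the eigenvector equation of [F + la P^-1 H^T H], with [H = C U],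
    multiplied by [P] to clear the inverse. *)
Lemma feedback_eigenvalue n1 (F : 'M[R]_n1) (U : 'M[R]_(n, n1))
    (V1 : 'M[R]_(n1, n)) (P : 'M[R]_n1) (v : 'cV[R[i]]_n1) (la mu : R[i]) :
  A *m U = U *m F -> V1 *m U = 1%:M ->
  (forall z, eigenvalue (complexify F) z -> complex.Re z = 0) ->
  gram_average F t @[t --> +oo] --> P ->
  complex.Re la < 0 -> 0 <= complex.Re mu ->
  complexify (P *m F) *m v + la *: (complexify ((C *m U)^T *m (C *m U)) *m v) =
    mu *: (complexify P *m v) -> v = 0.
Proof.
move=> AU VU FP gramP la0 mu0 Ev.
have [k [Z [W [Y [ZF Wskew YZ]]]]] := imaginary_part_isometry As AU VU FP.
pose H := C *m U; pose a := Re_mx v; pose b := Im_mx v.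
have sym := gram_limit_sym gramP.
have pos := gram_limit_gt0 ZF Wskew YZ gramP.
have skew := gram_limit_skew ZF Wskew YZ gramP.
have Punit := posdef_unitmx pos.
have Ea : P *m (F *m a) + (complex.Re la *: (H^T *m (H *m a)) -
    complex.Im la *: (H^T *m (H *m b))) =
    complex.Re mu *: (P *m a) - complex.Im mu *: (P *m b).
  have := congr1 (@Re_mx R _ _) Ev.
  by rewrite Re_mxD !Re_mxZ !Re_mul_real !Im_mul_real -!mulmxA.
have Eb : P *m (F *m b) + (complex.Im la *: (H^T *m (H *m a)) +
    complex.Re la *: (H^T *m (H *m b))) =
    complex.Im mu *: (P *m a) + complex.Re mu *: (P *m b).
  have := congr1 (@Im_mx R _ _) Ev.
  by rewrite Im_mxD !Im_mxZ !Re_mul_real !Im_mul_real -!mulmxA.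
have dH u w : dot u (H^T *m (H *m w)) = dot (H *m u) (H *m w).
  by rewrite dot_mull.
(* Pair with the conjugate of [v] and take real parts: the contribution of [P F] vanishes by [skew],
   and the cross terms in [Im la] and [Im mu] cancel by symmetry. *)
have energy : complex.Re la * (dot (H *m a) (H *m a) + dot (H *m b) (H *m b)) =
    complex.Re mu * (dot a (P *m a) + dot b (P *m b)).
  have := congr1 (dot a) Ea; have := congr1 (dot b) Eb.
  rewrite -!scaleNr !dotDr !dotZr !skew !dH (sym b a) (dotC (H *m b) (H *m a)).
  by lra.
have Pge0 u : 0 <= dot u (P *m u).
  by have [->|/pos/ltW//] := eqVneq u 0; rewrite /dot !mulmx0 mxE.
(* The two sides of [energy] have opposite signs, so both are zero. *)
have HH : dot (H *m a) (H *m a) + dot (H *m b) (H *m b) = 0.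
  apply/eqP; rewrite eq_le addr_ge0 ?dotvv_ge0 // andbT.
  by rewrite -(nmulr_rge0 _ la0) energy mulr_ge0 // addr_ge0.
move/eqP: HH; rewrite paddr_eq0 ?dotvv_ge0 // !dotvv_eq0.
move=> /andP[/eqP Ha /eqP Hb].
have cancelP u w : P *m u = P *m w -> u = w.
  by move=> /(congr1 (mulmx (invmx P))); rewrite !mulmxA mulVmx // !mul1mx.
have Fa : F *m a = complex.Re mu *: a - complex.Im mu *: b.
  apply: cancelP; rewrite mulmxBr -!scalemxAr -Ea Ha Hb !mulmx0 !scaler0.
  by rewrite subr0 addr0.
have Fb : F *m b = complex.Im mu *: a + complex.Re mu *: b.
  apply: cancelP; rewrite mulmxDr -!scalemxAr -Eb Ha Hb !mulmx0 !scaler0.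
  by rewrite !addr0.
(* [F] maps the span of [a] and [b] into itself, and [H] kills that span. *)
have HF l : H *m F ^+ l *m a = 0 /\ H *m F ^+ l *m b = 0.
  elim: l => [|l [IHa IHb]]; first by rewrite expr0 mulmx1.
  rewrite exprSr -[_ * F]/(_ *m F) -!mulmxA Fa Fb !mulmxBr !mulmxDr -!scalemxAr.
  by rewrite !mulmxA IHa IHb !scaler0 subr0 addr0.
have a0 := observable_zero AU VU ZF Wskew YZ (fun l => (HF l).1).
have b0 := observable_zero AU VU ZF Wskew YZ (fun l => (HF l).2).
by apply: Re_Im_mx_inj; rewrite ?Re_mx0 ?Im_mx0.
Qed.

Hypothesis algL : algorithm_output C A L.

Lemma coupled_eigenvalue (la mu : R[i]) : complex.Re la < 0 ->
  eigenvalue (complexify A + la *: complexify (L *m C)) mu -> complex.Re mu < 0.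
Proof.
move=> la0 /eigenvalue_colP[w Ew w0].
have [Are _] := As.
move: algL; rewrite /algorithm_output; case: eqP => [n10 L0|/eqP n10].
  move: Ew; rewrite L0 mul0mx complexify0 scaler0 addr0 => Ew.
  have muA : eigenvalue (complexify A) mu by apply/eigenvalue_colP; exists w.
  rewrite lt_neqAle Are // andbT.
  have : ~~ has (fun z : R[i] => complex.Re z == 0) (eigenvalues A).
    by rewrite has_count -leqNgt leqn0 -/(imag_dim A) n10.
  by move=> /hasPn; apply; rewrite mem_eigenvalues.
move=> [U [W [V [F [G [P [[SV VS] VAS FP gramP LE]]]]]]].
(* [F] has size [imag_dim A] and only purely imaginary eigenvalues, so it exhausts those of [A] on
   the axis and leaves none to [G]. *)
have Gre z : eigenvalue (complexify G) z -> complex.Re z < 0.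
  move=> Gz; have pe := perm_eigenvalues_block (conj SV VS) VAS.
  have zA : z \in eigenvalues A.
    by rewrite (perm_mem pe) mem_cat !mem_eigenvalues Gz orbT.
  rewrite lt_neqAle Are -?mem_eigenvalues // andbT.
  have : ~~ has (fun z : R[i] => complex.Re z == 0) (eigenvalues G).
    rewrite has_count -leqNgt.
    have /permP/(_ (fun z : R[i] => complex.Re z == 0)) := pe.
    rewrite count_cat -/(imag_dim A).
    have -> : count (fun z : R[i] => complex.Re z == 0) (eigenvalues F) =
        imag_dim A.
      rewrite -[RHS](size_eigenvalues F); apply/eqP; rewrite -all_count.
      by apply/allP => y; rewrite mem_eigenvalues => /FP ->.
    by move=> /eqP; rewrite -{1}[imag_dim A]addn0 eqn_add2l => /eqP <-.
  by move=> /hasPn; apply; rewrite mem_eigenvalues.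
rewrite ltNge; apply: contraNN w0 => mu0.
rewrite -(vsubmxK V) in SV VS VAS.
move: SV VS VAS; set V1 := usubmx V; set V2 := dsubmx V => SV VS VAS.
have UV : U *m V1 + W *m V2 = 1%:M by rewrite -mul_row_col.
move: (VS); rewrite mul_col_row -[RHS]/(scalar_mx 1) scalar_mx_block.
move=> /eq_block_mx[VU1 VW1 VU2 VW2].
have AS : A *m row_mx U W = row_mx (U *m F) (W *m G).
  rewrite -[LHS]mul1mx -SV -!mulmxA (mulmxA (col_mx V1 V2)) VAS.
  by rewrite mul_row_block !mulmx0 addr0 add0r.
have VA : col_mx V1 V2 *m A = col_mx (F *m V1) (G *m V2).
  rewrite -[LHS]mulmx1 -SV mulmxA VAS.
  by rewrite mul_block_col !mul0mx addr0 add0r.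
move: AS; rewrite mul_mx_row => /eq_row_mx[AU AW].
move: VA; rewrite mul_col_mx => /eq_col_mx[V1A V2A].
have LE' : L = U *m (invmx P *m (C *m U)^T) by rewrite LE mulmxA.
have V2L : V2 *m L = 0 by rewrite LE' mulmxA VU2 mul0mx.
have V1L : V1 *m L = invmx P *m (C *m U)^T by rewrite LE' mulmxA VU1 mul1mx.
(* Since [V2 L = 0], a nonzero [V2 w] would be an eigenvector of the Hurwitz matrix [G] for [mu]. *)
have V2w : complexify V2 *m w = 0.
  apply/eqP; apply: contraLR mu0 => V2w; rewrite -ltNge; apply: Gre.
  apply/eigenvalue_colP; exists (complexify V2 *m w) => //.
  have := congr1 (mulmx (complexify V2)) Ew.
  rewrite mulmxA mulmxDr -scalemxAr -!complexifyM mulmxA V2L mul0mx complexify0.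
  by rewrite scaler0 addr0 V2A complexifyM -mulmxA -scalemxAr.
pose v := complexify V1 *m w.
have wE : w = complexify U *m v.
  have := congr1 (fun M => complexify M *m w) UV.
  rewrite complexify1 mul1mx complexifyD !complexifyM mulmxDl -!mulmxA V2w.
  by rewrite mulmx0 addr0.
suff v0 : v = 0 by rewrite wE v0 mulmx0.
have [k [Z [Wk [Y [ZF Wskew YZ]]]]] := imaginary_part_isometry As AU VU1 FP.
have Punit := posdef_unitmx (gram_limit_gt0 ZF Wskew YZ gramP).
(* The eigenvector equation for [w = U v], multiplied on the left by [P V1], has the required form
   because [P V1 L = (C U)^T]. *)
apply: (feedback_eigenvalue AU VU1 FP gramP la0 mu0).
have E1 : complexify (P *m F) *m v = complexify (P *m V1) *m (complexify A *m w).
  by rewrite /v !mulmxA -!complexifyM -!mulmxA V1A.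
have E2 : complexify ((C *m U)^T *m (C *m U)) *m v =
    complexify (P *m V1) *m (complexify (L *m C) *m w).
  rewrite [in RHS]wE [RHS]mulmxA [RHS]mulmxA -!complexifyM; congr (complexify _ *m _).
  by rewrite -!mulmxA (mulmxA V1) V1L !mulmxA mulmxV // mul1mx.
rewrite E1 E2 scalemxAr -mulmxDr (scalemxAl la) -mulmxDl Ew -scalemxAr.
by rewrite /v mulmxA -complexifyM.
Qed.

End Algorithm.

End CoupledEigenvalue.

(** * Disagreement dynamics *)

Section ErrorDynamics.
Context {R : realType}.

(** Multiply [Y] by the factors in turn: the last nonzero product is killed by the next factor, so
    it is an eigenvector, and [S] has been preserved on the way. *)
Lemma common_eigenvector (K : fieldType) q d (M : 'M[K]_d)
    (S : 'M[K]_(q, d) -> Prop) (s : seq K) (Y : 'M[K]_(q, d)) :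
  (forall z Y, S Y -> S (Y *m (M - z%:M))) -> S Y -> Y != 0 ->
  Y *m foldr (fun z B => (M - z%:M) *m B) 1%:M s = 0 ->
  exists2 z, z \in s & exists Y', [/\ S Y', Y' != 0 & Y' *m M = z *: Y'].
Proof.
move=> SM; elim: s Y => [|z s IH] Y SY Y0 /=.
  by rewrite mulmx1 => Y0'; rewrite Y0' eqxx in Y0.
rewrite mulmxA => Ys.
have [Yz|Yz] := eqVneq (Y *m (M - z%:M)) 0.
  exists z; first exact: mem_head.
  exists Y; split=> //; apply/eqP; rewrite -subr_eq0 -mul_mx_scalar -mulmxBr.
  exact/eqP.
have [z' z's Y'P] := IH _ (SM z Y SY) Yz Ys.
by exists z' => //; rewrite in_cons z's orbT.
Qed.

Context {n m p : nat} (A : 'M[R]_n) (C : 'M[R]_(m, n)) (L : 'M[R]_(n, m)).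
Context (Gamma : 'M[R]_p) (r : 'cV[R]_p).
Hypotheses (As : neutrally_stable A) (CA : detectable C A).
Hypothesis algL : algorithm_output C A L.
Hypotheses (GammaC : connected_interconnection Gamma).
Hypotheses (rG : r^T *m Gamma = 0) (r1 : r^T *m const_mx 1 = 1%:M :> 'M[R]_1).

Local Notation one := (const_mx 1 : 'cV[R]_p).

Let one_r : one^T *m r = 1%:M.
Proof. by apply: trmx_inj; rewrite trmx_mul trmxK r1 trmx1. Qed.

Let Gamma_r : Gamma^T *m r = 0.
Proof. by apply: trmx_inj; rewrite trmx_mul trmxK rG trmx0. Qed.

Let one_Gamma : one^T *m Gamma^T = 0.
Proof. by rewrite -trmx_mul (interconnection_mul1 GammaC) trmx0. Qed.

(** Connectedness makes each row of [B] constant; pairing with [r], whose entries sum to 1, reads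
    off the constant. *)
Lemma disagreement_kernel q (B : 'M[R]_(q, p)) :
  B *m Gamma^T = 0 -> B *m r = 0 -> B = 0.
Proof.
move=> BG Br; apply/row_matrixP => i; rewrite row0.
have [c ci] : exists c, (row i B)^T = const_mx c.
  apply: (interconnection_kernel GammaC).
  by apply: trmx_inj; rewrite trmx_mul trmxK -row_mul BG row0 trmx0.
have Bi : row i B = c *: one^T.
  by apply: trmx_inj; rewrite ci; apply/colP => j; rewrite !mxE mulr1.
have := congr1 (row i) Br; rewrite row_mul row0 Bi -scalemxAl one_r.
by move=> /matrixP/(_ 0 0); rewrite !mxE mulr1 => ->; rewrite scale0r.
Qed.

(* Subtracting [Y *m r *m one^T] shifts the eigenvalues on the consensus
   subspace, where [A] acts, by [-1], and changes nothing on [Y *m r = 0]. *)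
Definition error_mx : 'M[R]_(n * p) :=
  lin_mx (mulmx A) + lin_mx (mulmx (L *m C)) *m lin_mx (mulmxr Gamma^T)
  - lin_mx (mulmxr (r *m one^T)).

Lemma mul_error_mx (Y : 'M[R]_(n, p)) :
  mxvec Y *m error_mx =
  mxvec (A *m Y + L *m C *m Y *m Gamma^T - Y *m (r *m one^T)).
Proof.
rewrite /error_mx mulmxBr mulmxDr (mulmxA (mxvec Y)) !mul_vec_lin /=.
by rewrite linearB linearD.
Qed.

Lemma error_mx_hurwitz z :
  eigenvalue (complexify error_mx) z -> complex.Re z < 0.
Proof.
move=> /eigenvalueP[u uE u0]; rewrite ltNge; apply: contraNN u0 => z0.
pose Y : 'M[R[i]]_(n, p) := vec_mx u.
have uY : u = mxvec Y by rewrite /Y vec_mxK.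
(* The real identity [mul_error_mx] passes to complex matrices by treating real and imaginary parts
   separately. *)
have YE : complexify A *m Y + complexify (L *m C) *m Y *m complexify Gamma^T
    - Y *m complexify (r *m one^T) = z *: Y.
  have ReY : mxvec (Re_mx Y) = Re_mx u.
    by apply/rowP => i; rewrite /Y; case/mxvec_indexP: i => i j; rewrite mxvecE !mxE.
  have ImY : mxvec (Im_mx Y) = Im_mx u.
    by apply/rowP => i; rewrite /Y; case/mxvec_indexP: i => i j; rewrite mxvecE !mxE.
  have ReM k l (B : 'M[R[i]]_(k, p)) (D : 'M[R]_(p, l)) :
    Re_mx (B *m complexify D) = Re_mx B *m D.
    by rewrite Re_mx_mul Re_complexify Im_complexify mulmx0 subr0.
  have ImM k l (B : 'M[R[i]]_(k, p)) (D : 'M[R]_(p, l)) :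
    Im_mx (B *m complexify D) = Im_mx B *m D.
    by rewrite Im_mx_mul Re_complexify Im_complexify mulmx0 addr0.
  apply: Re_Im_mx_inj; apply: (can_inj mxvecK).
    have := congr1 (@Re_mx R _ _) uE.
    rewrite Re_mx_mul Re_complexify Im_complexify mulmx0 subr0 -ReY.
    rewrite mul_error_mx => E1.
    rewrite Re_mxD -scaleN1r Re_mxZ /= oppr0 scale0r subr0 scaleN1r Re_mxD.
    rewrite !ReM !Re_mul_real E1 !Re_mxZ linearB !linearZ /= -ReY -ImY.
    by [].
  have := congr1 (@Im_mx R _ _) uE.
  rewrite Im_mx_mul Re_complexify Im_complexify mulmx0 addr0 -ImY.
  rewrite mul_error_mx => E1.
  rewrite Im_mxD -scaleN1r Im_mxZ /= oppr0 scale0r add0r scaleN1r Im_mxD.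
  rewrite !ImM !Im_mul_real E1 !Im_mxZ linearD !linearZ /= -ReY -ImY.
  by [].
rewrite uY; suff -> : Y = 0 by rewrite linear0.
have Gr : complexify Gamma^T *m complexify r = 0.
  by rewrite -complexifyM Gamma_r complexify0.
(* Multiplying by [r] removes the coupling and turns the subtracted term into [Y r]. A nonzero [Y r]
   would then belong to the eigenvalue [z + 1] of [A], of positive real part. *)
have Yr : Y *m complexify r = 0.
  apply/eqP; apply: contraLR z0 => Yr; rewrite -ltNge.
  have [Are _] := As.
  suff /Are : eigenvalue (complexify A) (z + 1).
    by case: (z) => a b /=; lra.
  apply/eigenvalue_colP; exists (Y *m complexify r) => //.
  have := congr1 (mulmx^~ (complexify r)) YE => /=.
  rewrite mulmxBl mulmxDl -!mulmxA Gr !mulmx0 addr0 -complexifyM -mulmxA.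
  rewrite one_r mulmx1 -scalemxAl => /eqP; rewrite subr_eq => /eqP ->.
  by rewrite scalerDl scale1r.
have {}YE : complexify A *m Y + complexify (L *m C) *m Y *m complexify Gamma^T =
    z *: Y.
  by rewrite -YE (complexifyM r) (mulmxA Y) Yr mul0mx subr0.
apply/eqP; apply: contraT => Y0.
have [s sP s0] := annihilating_product (complexify Gamma^T).
(* Right multiplication by [Gamma^T] commutes with the left multiplications, hence preserves the
   eigenspace inside [Y r = 0]. *)
pose S (Y : 'M[R[i]]_(n, p)) := Y *m complexify r = 0 /\
  complexify A *m Y + complexify (L *m C) *m Y *m complexify Gamma^T = z *: Y.
have SM y (B : 'M[R[i]]_(n, p)) : S B -> S (B *m (complexify Gamma^T - y%:M)).
  move=> [Br BE]; split.
    rewrite -mulmxA mulmxBl Gr sub0r mul_scalar_mx mulmxN -scalemxAr Br.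
    by rewrite scaler0 oppr0.
  rewrite scalemxAl -BE mulmxDl -!mulmxA; congr (_ + _ *m (_ *m _)).
  by rewrite mulmxBl mulmxBr scalar_mxC.
have SY : S Y by split.
have Ys : Y *m foldr (fun z B => (complexify Gamma^T - z%:M) *m B) 1%:M s = 0.
  by rewrite s0 mulmx0.
have [la las [B [[Br BE] B0 BG]]] := common_eigenvector SM SY Y0 Ys.
have {sP las} : eigenvalue (complexify Gamma) la.
  by have := sP _ las; rewrite complexify_tr eigenvalue_tr.
move=> /(interconnection_eigenvalue GammaC)[la0|la0].
  move: BG; rewrite la0 scale0r => BG; move/negP: B0; case; apply/eqP.
  apply: Re_Im_mx_inj; rewrite ?Re_mx0 ?Im_mx0; apply: disagreement_kernel.
  - have := congr1 (@Re_mx R _ _) BG.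
    by rewrite Re_mx_mul Re_complexify Im_complexify mulmx0 subr0 Re_mx0.
  - have := congr1 (@Re_mx R _ _) Br.
    by rewrite Re_mx_mul Re_complexify Im_complexify mulmx0 subr0 Re_mx0.
  - have := congr1 (@Im_mx R _ _) BG.
    by rewrite Im_mx_mul Re_complexify Im_complexify mulmx0 addr0 Im_mx0.
  - have := congr1 (@Im_mx R _ _) Br.
    by rewrite Im_mx_mul Re_complexify Im_complexify mulmx0 addr0 Im_mx0.
(* Left multiplication acts columnwise, so any nonzero column of [B] is an eigenvector of
   [A + la L C]. *)
have [j Bj] : exists j, col j B != 0.
  apply/existsP; rewrite -negb_forall; apply: contraNN B0 => /forallP B0.
  by apply/eqP/matrixP => i j; have /eqP/colP/(_ i) := B0 j; rewrite !mxE.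
suff : complex.Re z < 0 by rewrite ltNge z0.
apply: (coupled_eigenvalue As CA algL la0); apply/eigenvalue_colP.
have BzE : (complexify A + la *: complexify (L *m C)) *m B = z *: B.
  by rewrite -BE -mulmxA BG mulmxDl -scalemxAl -scalemxAr.
by exists (col j B) => //; rewrite colE mulmxA BzE -scalemxAl.
Qed.

End ErrorDynamics.

(** * The network in matrix form and its synchronization *)

Section Synchronization.
Context {R : realType} {n m p : nat}.
Implicit Types (A : 'M[R]_n) (x : 'I_p -> 'cV[R]_n).

Definition state_mx x : 'M[R]_(n, p) := \matrix_(k, i) x i k 0.

(** Vectorization identity: a Kronecker product acting on stacked columns multiplies the matrix of
    columns on both sides. *)
Lemma consensus_trajectoryE A (r : 'cV[R]_p) x (t : R) :
  consensus_trajectory A r x t = expm (t *: A) *m (state_mx x *m r).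
Proof.
apply/colP => k; rewrite /consensus_trajectory castmxE cast_ord_id mxE.
rewrite (reindex (@mxtens_index p n)) /=; last first.
  by apply: onW_bij; exists (@mxtens_unindex p n);
    [exact: mxtens_indexK|exact: mxtens_unindexK].
have kE : cast_ord (esym (mul1n n)) k = mxtens_index (0 : 'I_1, k).
  by apply/val_inj => /=; rewrite mul0n.
rewrite kE; under eq_bigr => ij _.
  rewrite {1}(surjective_pairing ij) tensmxE [stack _ _ _]mxE mxtens_indexK.
  over.
rewrite -(pair_big predT predT (fun i j => r^T 0 i * expm (t *: A) k j * x i j 0)) /=.
rewrite mxE exchange_big /=; apply: eq_bigr => j _.
rewrite mxE mulr_sumr; apply: eq_bigr => i _; rewrite !mxE.
by rewrite [RHS]mulrA [RHS]mulrC [RHS]mulrA.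
Qed.

Lemma coupled_state_derive A (C : 'M[R]_(m, n)) (L : 'M[R]_(n, m))
    (Gamma : 'M[R]_p) (x : 'I_p -> R -> 'cV[R]_n) (t : R) :
  interconnection Gamma -> coupled_solution A C L Gamma x -> 0 < t ->
  let X := fun s => state_mx (x^~ s) in
  is_derive_mx t X (A *m X t + L *m C *m X t *m Gamma^T).
Proof.
move=> [_ dG] xS t0 X k i.
have /(_ i)[_ /(_ t t0)/is_derive_mxP/(_ k 0)] := xS.
have -> : (fun s => x i s k 0) = (fun s => X s k i).
  by apply/funext => s; rewrite mxE.
have Xcol j : x j t = col j (X t) by apply/colP => l; rewrite !mxE.
have colM a b (B : 'M[R]_(a, b)) (D : 'M[R]_(b, p)) j :
  (B *m D) ^~ j =1 (B *m col j D) ^~ 0 by move=> l; rewrite !colE mulmxA -colE [RHS]mxE.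
move/is_derive_eq; apply; cbv beta zeta.
rewrite [LHS]mxE [RHS]mxE colM -Xcol; congr (_ + _).
rewrite -!mulmxA colM.
have -> : col i (C *m (X t *m Gamma^T)) = C *m col i (X t *m Gamma^T).
  by rewrite !colE !mulmxA.
(* The diagonal entry [Gamma i i], minus the sum of the others in its row, supplies the terms in
   [- x i t]. *)
have -> : col i (X t *m Gamma^T) = \sum_(j | j != i) Gamma i j *: (x j t - x i t).
  rewrite colE -mulmxA -colE; apply/colP => l.
  rewrite summxE !mxE [LHS](bigD1 i) //= !mxE dG mulrN mulr_sumr addrC -sumrB.
  by apply: eq_bigr => j _; rewrite !mxE; ring.
congr ((L *m _) k 0); rewrite mulmx_sumr; apply: eq_bigr => j _.
by rewrite -scalemxAr mulmxBr.
Qed.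

End Synchronization.

Theorem lemma2 (R : realType) (n m : nat) (A : 'M[R]_n) (C : 'M[R]_(m, n))
    (L : 'M[R]_(n, m)) :
  neutrally_stable A ->
  detectable C A ->
  algorithm_output C A L ->
  forall (p : nat) (Gamma : 'M[R]_p),
    connected_interconnection Gamma ->
    forall r : 'cV[R]_p,
      r^T *m Gamma = 0 ->
      r^T *m const_mx 1 = 1%:M :> 'M[R]_1 ->
      forall x : 'I_p -> R -> 'cV[R]_n,
        coupled_solution A C L Gamma x ->
        synchronize x (consensus_trajectory A r (fun i => x i 0)).
Proof.
move=> As CA algL p Gamma GammaC r rG r1 x xS.
pose X s := state_mx (x^~ s).
pose c s := expm (s *: A) *m (X 0 *m r).
have Gamma_r : Gamma^T *m r = 0 by apply: trmx_inj; rewrite trmx_mul trmxK rG trmx0.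
have one_r : (const_mx 1 : 'cV[R]_p)^T *m r = 1%:M.
  by apply: trmx_inj; rewrite trmx_mul trmxK r1 trmx1.
have one_Gamma : (const_mx 1 : 'cV[R]_p)^T *m Gamma^T = 0.
  by rewrite -trmx_mul (interconnection_mul1 GammaC) trmx0.
have dX (t : R) : 0 < t ->
    is_derive_mx t X (A *m X t + L *m C *m X t *m Gamma^T).
  by move=> t0; apply: coupled_state_derive => //; case: GammaC.
have dc (t : R) : is_derive_mx t c (A *m c t) by exact: is_derive_flow.
(* Both sides solve [u' = A u] with the same value at 0, since [Gamma^T r = 0] cancels the
   coupling. *)
have Xr (t : R) : 0 <= t -> X t *m r = c t.
  pose e s := X s *m r - c s.
  suff e0 : forall t : R, 0 <= t -> e t = 0.
    by move=> /e0 /eqP; rewrite /e subr_eq0 => /eqP.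
  apply: (@linear_ode_zero _ _ A) => [s s0|k|].
  - apply: is_derive_mx_eq (is_derive_mxB (is_derive_mulmxr r (dX s s0)) (dc s)) _.
    rewrite mulmxDl -(mulmxA _ Gamma^T) Gamma_r mulmx0 addr0 /e mulmxBr.
    by rewrite (mulmxA A (X s)).
  - have -> : (fun t => e t k 0) =
        (fun t => \sum_i x i t k 0 * r i 0 - c t k 0).
      apply/funext => s; rewrite 3!mxE; congr (_ - _).
      by apply: eq_bigr => i _; rewrite mxE.
    move=> s; apply: cvgB.
      apply: cvg_sumr => i; apply: cvgM; last exact: cvg_cst.
      have [cx _] := xS i.
      exact: (cvg_comp _ (fun M : 'cV[R]_n => M k 0) (cx s)
        (@coord_continuous _ _ _ k 0 _)).
    have cc : continuous (fun t => c t k 0).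
      move=> s1; apply/differentiable_continuous/derivable1_diffP.
      by have [] := dc s1 k 0.
    exact: (continuous_subspaceT cc).
  - by rewrite /e /c expm0 mul1mx subrr.
pose Y s := X s - c s *m (const_mx 1 : 'cV[R]_p)^T.
have dY (t : R) : 0 < t -> is_derive_mx t Y
    (A *m Y t + L *m C *m Y t *m Gamma^T - Y t *m (r *m (const_mx 1 : 'cV[R]_p)^T)).
  move=> t0; apply: is_derive_mx_eq
    (is_derive_mxB (dX t t0) (is_derive_mulmxr (const_mx 1 : 'cV[R]_p)^T (dc t))) _.
  (* As [Y r = 0] along the solution, subtracting this term changes nothing here, while it makes the
     operator Hurwitz. *)
  have -> : Y t *m (r *m (const_mx 1 : 'cV[R]_p)^T) = 0.
    rewrite mulmxA /Y mulmxBl Xr ?ltW // -(mulmxA (c t)) one_r mulmx1.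
    by rewrite subrr mul0mx.
  rewrite subr0 /Y !mulmxBr !mulmxBl -!mulmxA one_Gamma !mulmx0 subr0.
  by rewrite addrAC.
pose y s := (mxvec (Y s))^T.
have dy (t : R) : 0 < t -> is_derive_mx t y ((error_mx A C L Gamma r)^T *m y t).
  move=> t0; rewrite -trmx_mul mul_error_mx => k j; rewrite ord1 mxE.
  case/mxvec_indexP: k => a b; rewrite mxvecE; move: (dY t t0 a b).
  by congr is_derive; apply/funext => s; rewrite /y [RHS]mxE mxvecE.
have y0 k : y t k 0 @[t --> +oo] --> (0 : R).
  apply: hurwitz_decay dy k => z; rewrite complexify_tr eigenvalue_tr.
  exact: error_mx_hurwitz.
(* By continuity of the square root at 0, it suffices that the sum of squares under the Euclidean
   norm tends to 0; its terms are squared entries of [y]. *)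
move=> i; rewrite -[X in _ --> X]sqrtr0.
apply: (cvg_comp _ Num.sqrt); last exact: sqrt_continuous.
have S0 : \sum_(k < n) y t (mxvec_index k i) 0 ^+ 2 @[t --> +oo] --> (0 : R).
  have := cvg_sumr (fun k : 'I_n => sqr_cvg0 (y0 (mxvec_index k i))).
  by rewrite big1 //; exact.
apply: cvg_trans S0; apply: near_eq_cvg; apply: nearW => t /=.
apply: eq_bigr => k _; congr (_ ^+ 2).
rewrite consensus_trajectoryE -/(X 0) -/(c t) /y mxE mxvecE.
by rewrite !mxE big_ord1 !mxE mulr1.
Qed.
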